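(* Let $m\ge1$ be an integer, let $q=2^\ell$ be a power of two, and let $r$ be an integer with $1\le r<q$. The $[m,q-r,q]$-lifted-RS code has the following properties: 1. The length of the code is $q^m$. 2. The rate of the code is $1-\Theta\left((q/r)^{\log\lambda_m-m}\right)$ as $q\to\infty$ (with $m$ fixed and implied constants depending only on $m$). 3. The code is a $k$-batch code for $k=q^{m-2}r$.
   Context: $\log$ is the logarithm in base two. $\mathbb{F}_q$ is the field with $q$ elements and $[n]=\{1,\dots,n\}$. Lifted Reed-Solomon code. Let $\mathcal{L}_m$ be the set of all lines $(\mathbf{a}T+\mathbf{b})|_{T\in\mathbb{F}_q}$ in $\mathbb{F}_q^m$, with $\mathbf a,\mathbf b\in\mathbb{F}_q^m$. For a positive integer $d<q$ let $\mathcal{F}_{d,q}=\{f(T)\in\mathbb{F}_q[T]:\deg f<d\}$. The restriction $f|_L$ of a polynomial $f\in\mathbb{F}_q[X_1,\dots,X_m]$ to a line $L=(\mathbf aT+\mathbf b)|_{T\in\mathbb{F}_q}$ is the univariate polynomial $f(\mathbf aT+\mathbf b)$ reduced modulo $T^q-T$ (i.e. the function $T\mapsto f(\mathbf aT+\mathbf b)$ on $\mathbb{F}_q$ represented by its unique polynomial of degree at most $q-1$). The $[m,d,q]$-lifted-RS code is the linear code over $\mathbb{F}_q$ $$\left\{(f(\mathbf a))_{\mathbf a\in\mathbb{F}_q^m}:\ f\in\mathbb{F}_q[X_1,\dots,X_m],\ f|_L\in\mathcal{F}_{d,q}\text{ for all }L\in\mathcal{L}_m\right\}.$$ The rate of a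 linear code is its dimension divided by its length. Batch code. Let $F:\mathbb{F}_q^n\to\mathbb{F}_q^N$ be an encoding map (injective) sending $(x_1,\dots,x_n)$ to $(y_1,\dots,y_N)$ and let $\mathcal{C}$ be the image of $F$. The code $\mathcal{C}$ (with length $N$ and dimension $n$) is a $k$-batch code if for every multiset of message symbols $\{x_{i_1},\dots,x_{i_k}\}$, $i_j\in[n]$, there exist $k$ mutually disjoint sets $R_1,\dots,R_k\subset[N]$ and functions $g_1,\dots,g_k$ such that for all $\mathbf y=F(x_1,\dots,x_n)\in\mathcal{C}$ and all $j\in[k]$, $g_j(\mathbf y|_{R_j})=x_{i_j}$, where $\mathbf y|_R$ is the projection of $\mathbf y$ onto the coordinates in $R$. A linear code given as a set is called a $k$-batch code if it is the image of some such encoding map $F$, with $n$ equal to its dimension, for which this property holds. If $k>0$ is not an integer (which here happens only for $m=1$), ''$k$-batch'' means $\lceil k\rceil$-batch. The number $\lambda_m$. Let $A_m$ be the $m\times m$ matrix with rows and columns indexed by $0,1,\dots,m-1$ whose entry in row $j$ and column $0$ is $\binom{m}{\ge 2j+1}$ and whose entry in row $j$ and column $c\ge 1$ is $\binom{m}{2j+1-c}$. Here $\binom{b}{\ge a}$ is the number of subsets with at least $a$ elements of a $b$-element set, and $\binom{b}{a}=0$ if $a<0$ or $a>b$. Then $\lambda_m$ is the largest eigenvalue of $A_m$ ($A_m$ is entrywise non-negative, so this is its spectral radius). *)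

(* Defs.v *)
From HB Require Import structures.
From mathcomp Require Import all_boot all_order all_algebra.
From mathcomp Require Import boolp classical_sets reals.
From mathcomp Require Import mpoly.
Set Implicit Arguments.
Unset Strict Implicit.
Unset Printing Implicit Defensive.
Import GRing.Theory.
Local Open Scope ring_scope.

(* Linear codes over F whose coordinates are indexed by a finite type I. *)
Definition code (F : finFieldType) (I : finType) := {vspace {ffun I -> F^o}}.

Definition code_length (F : finFieldType) (I : finType) (C : code F I) : nat :=
  #|I|.

Definition code_rate (R : realType) (F : finFieldType) (I : finType)
    (C : code F I) : R :=
  (\dim C)%:R / (code_length C)%:R.

(* f(aT + b) reduced modulo T^q - T, where q = #|F|. *)
Definition restrict_line (F : finFieldType) (m : nat) (f : {mpoly F[m]})
    (a b : 'rV[F]_m) : {poly F} :=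
  mmap polyC (fun i => a 0 i *: 'X + (b 0 i)%:P) f %% ('X^#|F| - 'X).

Definition eval_word (F : finFieldType) (m : nat) (f : {mpoly F[m]}) :
    {ffun 'rV[F]_m -> F^o} :=
  [ffun x : 'rV[F]_m => f.@[x 0]].

(* [size p <= d] says that p is zero or has degree less than d.  The direction
   a = 0 is allowed; such a "line" is a point and the restriction a constant. *)
Definition lifted_RS_word (F : finFieldType) (m d : nat)
    (c : {ffun 'rV[F]_m -> F^o}) : Prop :=
  exists2 f : {mpoly F[m]},
    (forall a b : 'rV[F]_m, (size (restrict_line f a b) <= d)%N)
    & c = eval_word f.

(* These words already form a subspace, so the span adds nothing to them: see
   [mem_lifted_RS]. *)
Definition lifted_RS (F : finFieldType) (m d : nat) : code F 'rV[F]_m :=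
  <<[seq c : {ffun 'rV[F]_m -> F^o}
       <- enum {ffun 'rV[F]_m -> F} | `[< lifted_RS_word d c >]]>>%VS.

Lemma lifted_RS_word_linear (F : finFieldType) (m d : nat) (k : F)
    (u v : {ffun 'rV[F]_m -> F^o}) :
  lifted_RS_word d u -> lifted_RS_word d v -> lifted_RS_word d (k *: u + v).
Proof.
move=> [f hf ->] [g hg ->]; exists (k *: f + g) => [a b|].
  rewrite /restrict_line mmapD mmapZ mul_polyC modpD modpZl.
  apply: leq_trans (size_polyD _ _) _; rewrite geq_max hg andbT.
  exact: leq_trans (size_scale_leq _ _) (hf a b).
by apply/ffunP => x; rewrite !ffunE mevalD mevalZ.
Qed.

Lemma lifted_RS_word0 (F : finFieldType) (m d : nat) :
  @lifted_RS_word F m d 0.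
Proof.
exists 0 => [a b|]; first by rewrite /restrict_line mmap0 mod0p size_poly0.
by apply/ffunP => x; rewrite !ffunE meval0.
Qed.

Lemma mem_lifted_RS (F : finFieldType) (m d : nat)
    (c : {ffun 'rV[F]_m -> F^o}) :
  c \in lifted_RS F m d <-> lifted_RS_word d c.
Proof.
split=> [|cP]; last first.
  by apply: memv_span; rewrite mem_filter mem_enum andbT; apply/asboolP.
rewrite /lifted_RS; set s := filter _ _.
have: forall x, x \in s -> lifted_RS_word d x.
  by move=> x; rewrite mem_filter => /andP[/asboolP].
elim: s c => [|x s IH] c sP; first by rewrite span_nil memv0 => /eqP ->; exact: lifted_RS_word0.
rewrite span_cons => /memv_addP[_ /vlineP[k ->] [v vs ->]].
apply: lifted_RS_word_linear; first by apply: sP; rewrite mem_head.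
by apply: IH vs => y ys; apply: sP; rewrite in_cons ys orbT.
Qed.

Definition project (F : finFieldType) (I : finType) (y : {ffun I -> F^o})
    (S : {set I}) : {ffun {s : I | s \in S} -> F} :=
  [ffun s => y (val s)].

(* The encoding map is not required to be linear.  The multiset of k message
   symbols is given by a listing w of their indices, repetitions allowed. *)
Definition batch_code_nat (F : finFieldType) (I : finType) (C : code F I)
    (k : nat) : Prop :=
  exists enc : 'rV[F]_(\dim C) -> {ffun I -> F^o},
    [/\ injective enc,
        forall y, y \in C <-> exists x, y = enc x
      & forall w : k.-tuple 'I_(\dim C),
          exists (S : 'I_k -> {set I})
                 (g : forall j, {ffun {s : I | s \in S j} -> F} -> F),
            (forall i j, i != j -> [disjoint S i & S j]) /\
            (forall x j, g j (project (enc x) (S j)) = x 0 (tnth w j))].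

(* Meant for k > 0; a non-integral k is rounded up. *)
Definition batch_code (F : finFieldType) (I : finType) (C : code F I)
    (k : rat) : Prop :=
  batch_code_nat C `|Num.ceil k|%N.

Definition bin_ge (b a : nat) : nat := #|[set S : {set 'I_b} | (a <= #|S|)%N]|.

(* The test on c guards against the truncated subtraction of nat. *)
Definition lambda_mx (R : realType) (m : nat) : 'M[R]_m :=
  \matrix_(j < m, c < m)
    (if c == 0%N :> nat then bin_ge m (2 * j + 1)
     else if (c <= 2 * j + 1)%N then 'C(m, 2 * j + 1 - c) else 0%N)%:R.

(* The largest eigenvalue: the set of real eigenvalues of a matrix is finite,
   and that of this entrywise non-negative matrix is non-empty for m > 0
   because the spectral radius belongs to it, so the sup is a maximum. *)
Definition lambda (R : realType) (m : nat) : R :=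
  sup [set a | eigenvalue (lambda_mx R m) a]%classic.

(* Main.v *)
(* Monomials X^d with exponents below q form a basis of the functions on F^m.
   Expanding (a_j T + b_j)^(d_j) in characteristic 2 shows that the lifted code
   is spanned by the monomials X^d that are not bad, where d is bad if some i,
   below d digit by digit in base 2, has sum i_j reducing modulo q - 1 into
   [q - r, q - 1].  For r = 2^s this only concerns the top l - s binary digits of
   d up to a bounded carry; reading these from the most significant one, the
   carry that is still to be produced evolves exactly by the matrix A_m, so the
   number of bad d is of order 2^(s m) lambda_m^(l - s) by Perron-Frobenius.
   For the batch property, take a systematic encoding and serve the requests
   greedily: fewer than r q^(m-1) coordinates are in use at any time, so by
   averaging some line through the requested point has q - r free other points,
   and these determine the restriction of the codeword to the line. *)

Require Import Defs.
From mathcomp Require Import all_boot all_order all_algebra.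
From mathcomp Require Import reals exp.
From mathcomp Require Import boolp zify ring.
From mathcomp Require finfield mpoly classical_sets topology normedtype derive.
Set Implicit Arguments.
Unset Strict Implicit.
Unset Printing Implicit Defensive.
Import Order.TTheory GRing.Theory Num.Theory.
Local Open Scope ring_scope.

(** * Reduced monomials and restriction to lines *)

(** The exponent of T^e modulo T^q - T. Positive exponents land in 1, ..., q - 1 and 0 stays apart,
    because T^(q-1) and 1 differ at T = 0. *)
Definition redexp (q e : nat) : nat :=
  if e is e'.+1 then (e' %% q.-1).+1 else 0%N.

Lemma redexp_lt q e : (1 < q)%N -> (redexp q e < q)%N.
Proof.
case: e => [|e] q1 /=; first exact: ltnW.
by have := @ltn_pmod e q.-1; lia.
Qed.

Lemma redexp_small q e : (e < q)%N -> redexp q e = e.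
Proof. by case: e => //= e eq; rewrite modn_small //; lia. Qed.

Lemma redexpE q e : exists c, e = (c * q.-1 + redexp q e)%N.
Proof.
case: e => [|e]; first by exists 0%N.
by exists (e %/ q.-1)%N; rewrite /= {1}(divn_eq e q.-1) addnS.
Qed.

Lemma expf_redexp (F : finFieldType) (x : F) e : x ^+ e = x ^+ redexp #|F| e.
Proof.
have [->|x0] := eqVneq x 0.
  by case: e => [|e] //=; rewrite !expr0n.
have [c {1}->] := redexpE #|F| e.
suff xq : x ^+ #|F|.-1 = 1 by rewrite exprD mulnC exprM xq expr1n mul1r.
apply: (mulfI x0); rewrite -exprS mulr1 prednK ?finfield.expf_card //.
exact: ltnW (card_finNzRing_gt1 F).
Qed.

Lemma poly_eq_finField (F : finFieldType) (p p' : {poly F}) :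
  (size p <= #|F|)%N -> (size p' <= #|F|)%N -> (forall t, p.[t] = p'.[t]) ->
  p = p'.
Proof.
move=> sp sp' pp'; apply/eqP; rewrite -subr_eq0; apply/eqP.
apply: (roots_geq_poly_eq0 (rs := enum F)); last first.
- rewrite -cardE; apply: leq_trans (size_polyD _ _) _.
  by rewrite size_polyN geq_max sp.
- exact: enum_uniq.
by apply/allP => t _; rewrite rootE !hornerE pp' subrr.
Qed.

Definition mono (F : finFieldType) m (d : 'I_m -> nat) (x : 'rV[F]_m) : F :=
  \prod_j x 0 j ^+ d j.

Section Monomials.
Variables (F : finFieldType) (q m : nat).
Hypothesis hq : #|F| = q.
Local Notation expo := {ffun 'I_m -> 'I_q}.

Definition of_coefs (c : {ffun expo -> F}) : {ffun 'rV[F]_m -> F} :=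
  [ffun x => \sum_d c d * mono (fun j => d j) x].

(* The indicator of a point y is the product of the 1 - (x_j - y_j)^(q-1). *)
Lemma of_coefs_surj (f : {ffun 'rV[F]_m -> F}) : exists c, of_coefs c = f.
Proof.
have q1 : (1 < q)%N by rewrite -hq card_finNzRing_gt1.
pose P (y : F) : {poly F} := 1 - ('X - y%:P) ^+ q.-1.
have sP y : (size (P y) <= q)%N.
  apply: leq_trans (size_polyD _ _) _; rewrite size_polyN size_poly1 geq_max.
  by rewrite size_exp_XsubC; lia.
have PE y x : (P y).[x] = (x == y)%:R.
  rewrite !hornerE -subr_eq0.
  have [->|xy] := eqVneq (x - y) 0.
    by rewrite expr0n; case: (q) q1 => [|[|]] //= *; rewrite subr0.
  suff -> : (x - y) ^+ q.-1 = 1 by rewrite subrr.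
  apply: (mulfI xy); rewrite -exprS mulr1 prednK ?(ltnW q1) // -hq.
  exact: finfield.expf_card.
exists [ffun d : expo => \sum_(y : 'rV[F]_m) f y * \prod_j (P (y 0 j))`_(d j)].
apply/ffunP => x; rewrite ffunE.
transitivity (\sum_(y : 'rV[F]_m) f y * \prod_j (P (y 0 j)).[x 0 j]).
  under eq_bigr do rewrite ffunE mulr_suml.
  rewrite exchange_big; apply: eq_bigr => y _ /=.
  under eq_bigr do rewrite -mulrA -big_split /=.
  rewrite -mulr_sumr; congr (_ * _).
  rewrite -(bigA_distr_bigA (fun j (i : 'I_q) => (P (y 0 j))`_i * x 0 j ^+ i)).
  by apply: eq_bigr => j _; rewrite (horner_coef_wide _ (sP _)).
rewrite (bigD1 x) //= [X in _ + X]big1 ?addr0 => [|y yx].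
  by rewrite big1 ?mulr1 // => j _; rewrite PE eqxx.
have [j yxj] : exists j, y 0 j != x 0 j.
  apply/existsP; apply: contraNT yx; rewrite negb_exists => /forallP h.
  by apply/eqP/rowP => j; apply/eqP; move: (h j); rewrite negbK.
by rewrite (bigD1 j) //= PE eq_sym (negPf yxj) mul0r mulr0.
Qed.

(** A surjection between finite sets of equal size is injective. *)
Lemma of_coefs_inj : injective of_coefs.
Proof.
pose g f := sval (cid (of_coefs_surj f)).
have gK : cancel g of_coefs by move=> f; rewrite /g; case: cid.
have [h _ hK] : bijective g.
  apply: inj_card_bij (can_inj gK) _.
  by rewrite !card_ffun card_mx !card_ord hq mul1n leqnn.
by move=> x y; rewrite -(hK x) -(hK y) !gK => ->.
Qed.

Lemma mono_indep (c : expo -> F) :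
  (forall x, \sum_d c d * mono (fun j => d j) x = 0) -> forall d, c d = 0.
Proof.
move=> c0 d; have /ffunP/(_ d) : [ffun d => c d] = 0 :> {ffun expo -> F}.
  apply: of_coefs_inj; apply/ffunP => x; rewrite !ffunE.
  under eq_bigr do rewrite ffunE.
  by rewrite c0 big1 // => e _; rewrite ffunE mul0r.
by rewrite !ffunE.
Qed.

End Monomials.

Section Lines.
Import mpoly.
Variables (F : finFieldType) (m : nat).

Lemma horner_mmap (f : {mpoly F[m]}) (a b : 'rV[F]_m) t :
  (mmap polyC (fun i => a 0 i *: 'X + (b 0 i)%:P) f).[t]
  = meval ((t *: a + b) 0) f.
Proof.
rewrite mevalE /mmap horner_sum; apply: eq_bigr => d _.
rewrite hornerM hornerC /mmap1 horner_prod; congr (_ * _).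
by apply: eq_bigr => i _; rewrite !hornerE !mxE mulrC.
Qed.

Lemma size_XqsubX : size ('X^#|F| - 'X : {poly F}) = #|F|.+1.
Proof.
rewrite size_polyDl ?size_polyXn // size_polyN size_polyX ltnS.
exact: card_finNzRing_gt1.
Qed.

Lemma size_restrict_line (f : {mpoly F[m]}) a b :
  (size (restrict_line f a b) <= #|F|)%N.
Proof. by rewrite -ltnS -size_XqsubX ltn_modp -size_poly_eq0 size_XqsubX. Qed.

Lemma horner_restrict_line (f : {mpoly F[m]}) a b t :
  (restrict_line f a b).[t] = meval ((t *: a + b) 0) f.
Proof.
rewrite -horner_mmap [in RHS](divp_eq (mmap _ _ _) ('X^#|F| - 'X)).
by rewrite hornerD hornerM !hornerE finfield.expf_card subrr mulr0 add0r.
Qed.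

(** Removes multivariate polynomials from the definition: every function on F^m is polynomial, and a
    restriction of degree below q is determined by its values. *)
Lemma lifted_RSP d (c : {ffun 'rV[F]_m -> F^o}) : (d <= #|F|)%N ->
  c \in lifted_RS F m d <->
  forall a b, exists2 p : {poly F}, (size p <= d)%N
                 & forall t, c (t *: a + b) = p.[t].
Proof.
move=> dq; rewrite mem_lifted_RS; split=> [[f hf ->] a b|hc].
  by exists (restrict_line f a b) => // t; rewrite ffunE horner_restrict_line.
have [e eE] := of_coefs_surj (erefl #|F|) c.
pose f : {mpoly F[m]} := \sum_(i : {ffun 'I_m -> 'I_#|F|})
  mpolyC m (e i) * \prod_j 'X_j ^+ i j.
have fE (x : 'rV[F]_m) : meval (x 0) f = c x.
  rewrite -eE ffunE rmorph_sum; apply: eq_bigr => i _ /=.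
  rewrite mevalM mevalC rmorph_prod; congr (_ * _).
  by apply: eq_bigr => j _; rewrite rmorphXn /= mevalXU.
exists f => [a b|]; last by apply/ffunP => x; rewrite ffunE fE.
have [p sp pE] := hc a b; rewrite (_ : restrict_line f a b = p) //.
apply: poly_eq_finField (size_restrict_line _ _ _) (leq_trans sp dq) _ => t.
by rewrite horner_restrict_line fE -pE.
Qed.

End Lines.

(** * The dimension of the lifted code *)

(** Lucas' theorem for one binary digit: Pascal's rule leads from row 2i to row 2i + 1 and on to row
    2i + 2. *)
Lemma odd_bin2 n k (x y : bool) :
  odd 'C(n.*2 + x, k.*2 + y) = odd 'C(n, k) && (y ==> x).
Proof.
have step i : (forall k, odd 'C(i.*2, k.*2) = odd 'C(i, k)) ->
    (forall k, odd 'C(i.*2, k.*2.+1) = false) ->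
    forall k, odd 'C(i.*2.+1, k.*2) = odd 'C(i, k) /\
              odd 'C(i.*2.+1, k.*2.+1) = odd 'C(i, k).
  move=> ev od [|j]; first by rewrite !bin0 binS bin0 oddD od.
  by rewrite binS oddD ev od [in X in X /\ _]doubleS binS oddD -doubleS ev od addbF.
have [base0 base1] : (forall k, odd 'C(n.*2, k.*2) = odd 'C(n, k)) /\
    (forall k, odd 'C(n.*2, k.*2.+1) = false).
  elim: n => [|i [ev od]]; first by split=> [[|j]|[|j]].
  split=> [[|j]|j]; first by rewrite !bin0.
    rewrite !doubleS binS oddD -doubleS.
    by rewrite (step i ev od j).2 (step i ev od j.+1).1 binS oddD.
  by rewrite doubleS binS oddD (step i ev od j).1 (step i ev od j).2 addbb.
case: x y => [] [] /=; rewrite ?addn1 ?addn0 ?base0 ?base1 ?andbT ?andbF //.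
  by rewrite (step n base0 base1 k).2.
by rewrite (step n base0 base1 k).1.
Qed.

(* Lucas' theorem modulo 2, for a block of n binary digits. *)
Lemma odd_bin_split n T D t h : (D < 2 ^ n)%N -> (h < 2 ^ n)%N ->
  odd 'C(T * 2 ^ n + D, t * 2 ^ n + h) = odd 'C(T, t) && odd 'C(D, h).
Proof.
elim: n D h => [|n IH] D h.
  by rewrite expn0 !ltnS !leqn0 => /eqP-> /eqP->; rewrite !muln1 !addn0 bin0 andbT.
rewrite expnS => Dn hn.
have E u v : (u * (2 * 2 ^ n) + v = (u * 2 ^ n + v./2).*2 + odd v)%N.
  by rewrite -{1}(odd_double_half v); lia.
have {2}-> : D = (D./2.*2 + odd D)%N by rewrite addnC odd_double_half.
have {2}-> : h = (h./2.*2 + odd h)%N by rewrite addnC odd_double_half.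
by rewrite !E !odd_bin2 IH ?andbA //; lia.
Qed.

(* The paper's bad exponents are those with e0 = q - r. *)
Definition bad (q e0 m : nat) (d : 'I_m -> nat) : Prop :=
  exists2 i : 'I_m -> nat, forall j, odd 'C(d j, i j)
                         & (e0 <= redexp q (\sum_j i j))%N.

Definition num_bad (q e0 m : nat) : nat :=
  #|[pred d : {ffun 'I_m -> 'I_q} | `[< bad q e0 (fun j => d j) >]]|.

Lemma odd_bin_leq n k : odd 'C(n, k) -> (k <= n)%N.
Proof. by apply: contraTT; rewrite -ltnNge => /bin_small ->. Qed.

Section Dimension.
Variables (F : finFieldType) (q m : nat).
Hypotheses (hq : #|F| = q) (pchar2 : 2 \in [pchar F]).
Local Notation expo := {ffun 'I_m -> 'I_q}.

(** By Lucas' theorem, i is below d digit by digit; such i index the terms of X^d on a line that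
    survive in characteristic 2. *)
Definition wt (d i : expo) : bool := [forall j, odd 'C(d j, i j)].

Lemma expr_line (d : 'I_q) (t a b : F) :
  (t * a + b) ^+ d =
  \sum_(i < q) (odd 'C(d, i))%:R * (t ^+ i * (a ^+ i * b ^+ (d - i))).
Proof.
rewrite addrC exprDn (big_ord_widen_cond q xpredT
  (fun i => (b ^+ (d - i) * (t * a) ^+ i) *+ 'C(d, i)) (ltn_ord d)) /=.
rewrite big_mkcond; apply: eq_bigr => i _.
rewrite exprMn -mulr_natl ltnS; case: leqP => [_|/bin_small->]; last by rewrite mul0r.
have -> : 'C(d, i)%:R = (odd 'C(d, i))%:R :> F.
  rewrite -{1}(odd_double_half 'C(d, i)) natrD -muln2 natrM.
  by rewrite (pcharf0 pchar2) mulr0 addr0.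
by ring.
Qed.

Lemma mono_line (d : expo) (a b : 'rV[F]_m) t :
  mono (fun j => d j) (t *: a + b) =
  \sum_(i : expo) (wt d i)%:R * (t ^+ (\sum_j i j) *
     (mono (fun j => i j) a * mono (fun j => d j - i j)%N b)).
Proof.
transitivity (\prod_j (\sum_(i < q) (odd 'C(d j, i))%:R *
    (t ^+ i * (a 0 j ^+ i * b 0 j ^+ (d j - i))))).
  by apply: eq_bigr => j _; rewrite !mxE expr_line.
rewrite bigA_distr_bigA; apply: eq_bigr => i _ /=.
rewrite !big_split /= prodrXr; congr (_ * _).
have [/forallP h|/forallPn[j hj]] := boolP (wt d i).
  by rewrite big1 // => j _; rewrite h.
by rewrite (bigD1 j) //= (negPf hj) mul0r.
Qed.

(** The restriction to aT + b, grouped by the exponent i of a rather than by d, so that each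
    coefficient is a combination of distinct reduced monomials in a. *)
Definition line_poly (e : expo -> F) (a b : 'rV[F]_m) : {poly F} :=
  \sum_(i : expo) ((\sum_(d | wt d i) e d * mono (fun j => d j - i j)%N b)
     * mono (fun j => i j) a) *: 'X^(redexp q (\sum_j i j)).

Lemma horner_line_poly (e : {ffun expo -> F}) a b t :
  (line_poly e a b).[t] = of_coefs e (t *: a + b).
Proof.
rewrite ffunE horner_sum; under [RHS]eq_bigr do rewrite mono_line mulr_sumr.
rewrite exchange_big; apply: eq_bigr => i _ /=.
have XE s : t ^+ redexp q s = t ^+ s by rewrite -hq -expf_redexp.
rewrite !hornerE XE !mulr_suml big_mkcond.
by apply: eq_bigr => d _; case: (wt d i) => /=; ring.
Qed.

Lemma size_line_poly e a b : (size (line_poly e a b) <= q)%N.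
Proof.
apply: leq_trans (size_sum _ _ _) _; apply/bigmax_leqP => i _.
apply: leq_trans (size_scale_leq _ _) _; rewrite size_polyXn redexp_lt //.
by rewrite -hq card_finNzRing_gt1.
Qed.

(** If e vanishes on bad exponents, all terms of degree at least e0 drop out of [line_poly].
    Conversely such a coefficient vanishes for all a and b; independence of monomials, first in a
    and then in b, isolates e d. *)
Lemma of_coefs_lifted (e : {ffun expo -> F}) e0 : (e0 <= q)%N ->
  of_coefs e \in lifted_RS F m e0 <->
  forall d : expo, bad q e0 (fun j => d j) -> e d = 0.
Proof.
move=> e0q; rewrite lifted_RSP ?hq //; split=> [h d [i0 hi0 hi]|h a b]; last first.
  exists (line_poly e a b) => [|t]; last by rewrite horner_line_poly.
  apply: leq_trans (size_sum _ _ _) _; apply/bigmax_leqP => i _.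
  have [small|big] := ltnP (redexp q (\sum_j i j)) e0.
    by apply: leq_trans (size_scale_leq _ _) _; rewrite size_polyXn.
  rewrite big1 ?mul0r ?scale0r ?size_poly0 // => d /forallP wdi.
  by rewrite h ?mul0r //; exists (fun j => i j : nat).
have i0q j : (i0 j < q)%N by apply: leq_ltn_trans (odd_bin_leq (hi0 j)) (ltn_ord _).
have [i iE] : exists i : expo, forall j, i j = i0 j :> nat.
  by exists [ffun j => Ordinal (i0q j)] => j; rewrite ffunE.
have wdi : wt d i by apply/forallP => j; rewrite iE.
have dq j : (d j - i j < q)%N by apply: leq_ltn_trans (leq_subr _ _) (ltn_ord _).
have [d' d'E] : exists d' : expo, forall j, (d' j = d j - i j :> nat)%N.
  by exists [ffun j => Ordinal (dq j)] => j; rewrite ffunE.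
pose k := redexp q (\sum_j i j).
have coef0 a b : (line_poly e a b)`_k = 0.
  have [p sp pE] := h a b.
  have <- : p = line_poly e a b.
    apply: poly_eq_finField; rewrite ?hq ?size_line_poly ?(leq_trans sp) // => t.
    by rewrite horner_line_poly -pE.
  by rewrite nth_default // (leq_trans sp) // /k (eq_bigr _ (fun j _ => iE j)).
have inner b : \sum_(d | wt d i) e d * mono (fun j => d j - i j)%N b = 0.
  (* Only the exponents whose sum reduces to k contribute to the coefficient of T^k. *)
  pose g (i : expo) := if redexp q (\sum_j i j) == k then
    \sum_(d | wt d i) e d * mono (fun j => d j - i j)%N b else 0.
  suff : g i = 0 by rewrite /g eqxx.
  apply: (mono_indep hq) => a; rewrite -[RHS](coef0 a b) coef_sum.
  apply: eq_bigr => i' _; rewrite coefZ coefXn /g eq_sym.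
  by case: eqP => _; rewrite ?mulr1 ?mulr0 ?mul0r.
(* For exponents above i digit by digit the subtraction of i is not truncated, hence it can be
   undone. *)
have subK (d1 : expo) : wt d1 i -> (forall j, d1 j - i j = d' j)%N -> d1 = d.
  move=> /forallP w1 d1E; apply/ffunP => j; apply: val_inj => /=.
  have := odd_bin_leq (w1 j); have := odd_bin_leq (forallP wdi j).
  by have := d1E j; rewrite d'E; lia.
(* The coefficient of the monomial d2 in b; at d' only d contributes. *)
pose g (d2 : expo) := \sum_(d1 | wt d1 i && [forall j, d1 j - i j == d2 j]%N) e d1.
have := mono_indep hq (c := g) _ d'; rewrite /g => g0.
rewrite -[RHS]g0 => [|b].
  rewrite (big_pred1 d) // => d1 /=; apply/andP/eqP => [[w1 /forallP h1]|->].
    by apply: subK => // j; apply/eqP/h1.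
  by split=> //; apply/forallP => j; rewrite d'E.
rewrite -[RHS](inner b); under eq_bigr do rewrite mulr_suml big_mkcondr /=.
rewrite exchange_big; apply: eq_bigr => d1 w1 /=.
have d1q j : (d1 j - i j < q)%N by apply: leq_ltn_trans (leq_subr _ _) (ltn_ord _).
rewrite -big_mkcond (big_pred1 [ffun j => Ordinal (d1q j)]) => [|d2] /=.
  by congr (_ * _); apply: eq_bigr => j _; rewrite ffunE.
apply/forallP/eqP => [h1|-> j]; last by rewrite ffunE.
by apply/ffunP => j; apply: val_inj; rewrite ffunE /=; apply/esym/eqP/h1.
Qed.

Lemma dim_lifted_RS e0 : (e0 <= q)%N ->
  (\dim (lifted_RS F m e0) + num_bad q e0 m = q ^ m)%N.
Proof.
move=> e0q.
pose good := [pred d : expo | ~~ `[< bad q e0 (fun j => d j) >]].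
suff -> : \dim (lifted_RS F m e0) = #|good|.
  by rewrite addnC /num_bad cardC card_ffun !card_ord.
(* The dimension is read off from the number of codewords, which [of_coefs] matches with the
   coefficient families supported on good exponents. *)
apply/(@expnI q); first by rewrite -hq card_finNzRing_gt1.
rewrite -{1}hq -(@finfield.card_vspace F {ffun 'rV[F]_m -> F}) /=.
have -> : (q ^ #|good| = #|pffun_on (0%R : F) good predT|)%N.
  by rewrite card_pffun_on; congr (_ ^ _)%N; rewrite -hq; apply: eq_card.
rewrite -(card_imset _ (of_coefs_inj hq)); apply: eq_card => c.
apply/idP/imsetP => [cC|[e /pffun_onP[eg _] ->]].
  have [e eE] := of_coefs_surj hq c; exists e => //; apply/pffun_onP; split=> //.
  apply/subsetP => d; rewrite !inE; apply: contraNN => /asboolP db.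
  by apply/eqP; move: d db; apply/(@of_coefs_lifted e e0 e0q); rewrite eE.
apply/(@of_coefs_lifted e e0 e0q) => d db; apply/eqP; apply: contraTT isT => ed.
have := subsetP eg d; rewrite !inE => /(_ ed) /negP; case.
exact/asboolP.
Qed.

End Dimension.

(** * Counting bad exponents *)

Definition lambda_entry (m j c : nat) : nat :=
  if c == 0%N then bin_ge m (2 * j + 1)
  else if (c <= 2 * j + 1)%N then 'C(m, 2 * j + 1 - c) else 0%N.

Section Reach.
Local Open Scope nat_scope.
Variable m : nat.

(* A carry of j is to be produced by digit-wise subsums of the n-digit numbers
   d k, whose target (j + 1) 2^n - 1 may be missed by at most K from below. *)
Definition reach (n K j : nat) (d : 'I_m -> nat) : Prop :=
  exists h : 'I_m -> nat, [/\ forall k, odd 'C(d k, h k),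
    j.+1 * 2 ^ n <= \sum_k h k + K.+1 & \sum_k h k < j.+1 * 2 ^ n].

Definition num_reach (n K j : nat) : nat :=
  #|[pred d : {ffun 'I_m -> 'I_(2 ^ n)} | `[< reach n K j (fun k => d k) >]]|.

Lemma eq_reach n K j d d' : d =1 d' -> reach n K j d -> reach n K j d'.
Proof. by move=> dd' [h [h1 h2 h3]]; exists h; split=> // k; rewrite -dd'. Qed.

Lemma sum_mem (T : finType) (S : {set T}) : \sum_k (k \in S : nat) = #|S|.
Proof. by rewrite -sum1_card [RHS]big_mkcond; apply: eq_bigr => k _; case: ifP. Qed.

Lemma exists_subset (T : finType) (S : {set T}) t :
  t <= #|S| -> exists2 S' : {set T}, S' \subset S & #|S'| = t.
Proof.
rewrite -bin_gt0 -cards_draws => /card_gt0P[S']; rewrite inE => /andP[S'S /eqP].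
by exists S'.
Qed.

(** S holds the positions whose top digit is 1. Choosing t of them contributes t 2^n, so the target
    (j + 1) 2^(n+1) - 1 leaves (2j + 2 - t) 2^n - 1, a carry of 2j + 1 - t for the lower n
    digits. *)
Lemma reach_top n K j (S : {set 'I_m}) (d : 'I_m -> nat) :
  (forall k, d k < 2 ^ n) ->
  reach n.+1 K j (fun k => (k \in S) * 2 ^ n + d k) <->
  exists t, [/\ t <= #|S|, t <= j.*2.+1 & reach n K (j.*2.+1 - t) d].
Proof.
have splitE t : t <= j.*2.+1 ->
    j.+1 * (2 * 2 ^ n) = (j.*2.+1 - t).+1 * 2 ^ n + t * 2 ^ n.
  by move=> tj; rewrite -mulnDl mulnA; congr (_ * _); lia.
move=> dn; split=> [[h [hd lo hi]]|[t [tS tj [h [hd lo hi]]]]].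
  have n0 : 0 < 2 ^ n by rewrite expn_gt0.
  have hE k : h k = h k %/ 2 ^ n * 2 ^ n + h k %% 2 ^ n by apply: divn_eq.
  have hdk k : odd 'C(k \in S, h k %/ 2 ^ n) && odd 'C(d k, h k %% 2 ^ n).
    by rewrite -(odd_bin_split (n := n)) ?ltn_pmod // -hE.
  have sE : \sum_k h k = (\sum_k h k %/ 2 ^ n) * 2 ^ n + \sum_k h k %% 2 ^ n.
    by under eq_bigr do rewrite hE; rewrite big_split /= big_distrl.
  set t := \sum_k h k %/ 2 ^ n in sE; rewrite sE expnS in lo hi.
  have tS : t <= #|S|.
    by rewrite -sum_mem; apply: leq_sum => k _; case/andP: (hdk k) => /odd_bin_leq.
  have tj : t <= j.*2.+1 by rewrite -ltnS -(ltn_pmul2r n0); lia.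
  exists t; split=> //; exists (fun k => h k %% 2 ^ n); split=> [k||].
  - by case/andP: (hdk k).
  - by move: lo; rewrite (splitE t tj); lia.
  - by move: hi; rewrite (splitE t tj); lia.
have [S' S'S S't] := exists_subset tS.
have hn k : h k < 2 ^ n by apply: leq_ltn_trans (odd_bin_leq (hd k)) (dn k).
exists (fun k => (k \in S') * 2 ^ n + h k); split=> [k||].
- rewrite odd_bin_split // hd andbT.
  by have := subsetP S'S k; case: (k \in S') => [->|_] //; rewrite bin0.
- rewrite big_split /= -big_distrl /= sum_mem S't expnS.
  by rewrite (splitE t tj) addnC -addnA leq_add2l.
rewrite big_split /= -big_distrl /= sum_mem S't expnS.
by rewrite (splitE t tj) addnC ltn_add2r.
Qed.

Lemma top_bitE n (d : 'I_m -> nat) : (forall k, d k < 2 ^ n.+1) ->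
  d =1 (fun k => (k \in [set k | 2 ^ n <= d k]) * 2 ^ n + d k %% 2 ^ n).
Proof.
move=> dn k; have := dn k; rewrite inE expnS => dk.
case: leqP => [nd|dn']; last by rewrite modn_small.
by rewrite -{2}(subnK nd) modnDr modn_small //; lia.
Qed.

(** Smaller carries are easier. If the t top digits used for j + 1 still fit, the remaining carry
    drops by two; otherwise 2j + 1 of them are used and carry 0 remains. *)
Lemma reach_pred n K j (d : 'I_m -> nat) : (forall k, d k < 2 ^ n) ->
  reach n K j.+1 d -> reach n K j d.
Proof.
elim: n j d => [|n IH] j d dn.
  move=> [h [hd lo hi]]; exists h; split=> //.
    by apply: leq_trans lo; rewrite leq_mul2r ltnW.
  rewrite big1 // => k _; apply/eqP; rewrite -leqn0.
  by apply: leq_trans (odd_bin_leq (hd k)) _; have := dn k.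
have dE := top_bitE dn; set S := [set _ | _] in dE.
have n0 : 0 < 2 ^ n by rewrite expn_gt0.
have dn' k : d k %% 2 ^ n < 2 ^ n by rewrite ltn_pmod.
move=> /(eq_reach dE)/(reach_top _ _ _ dn')[t [tS tj rt]].
apply: (eq_reach (fun k => esym (dE k))); apply/(reach_top _ _ _ dn').
have [t2|t2] := leqP t j.*2.+1.
  exists t; split=> //; do 2!apply: (IH) => //.
  by move: rt; rewrite (_ : j.+1.*2.+1 - t = (j.*2.+1 - t).+2); last lia.
exists j.*2.+1; rewrite subnn leqnn (leq_trans (ltnW t2) tS); split=> //.
have [tE|tN] := eqVneq t j.*2.+2.
  by apply: IH => //; move: rt; rewrite tE doubleS subSnn.
by move: rt; rewrite (_ : _ - t = 0) //; lia.
Qed.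

Lemma num_reach0 K j : num_reach 0 K j = (j <= K).
Proof.
rewrite /num_reach; have [jK|Kj] := leqP j K.
  rewrite (eq_card (B := predT)) ?card_ffun ?card_ord ?exp1n // => d.
  rewrite !inE; apply/asboolP; exists (fun=> 0).
  by rewrite big1 // add0n; split=> [k||]; rewrite ?bin0 // expn0 muln1.
rewrite eq_card0 // => d; apply/negbTE; rewrite inE; apply/asboolP => -[h [hd lo _]].
move: lo; rewrite big1 ?muln1 ?add0n => [|k _]; first by rewrite ltnS leqNgt Kj.
apply/eqP; rewrite -leqn0.
by apply: leq_trans (odd_bin_leq (hd k)) _; rewrite -ltnS.
Qed.

(** The sum is at most m (2^n - 1), which falls short of (m + 1) 2^n - 1 by at least m > K. Hence
    the states 0, ..., m - 1 suffice. *)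
Lemma num_reach_large n K j : K < m -> m <= j -> num_reach n K j = 0.
Proof.
move=> Km mj; rewrite /num_reach eq_card0 // => d; apply/negbTE; rewrite inE.
apply/asboolP => -[h [hd lo _]].
have : \sum_k h k <= \sum_(k < m) (2 ^ n).-1.
  apply: leq_sum => k _; rewrite -ltnS prednK ?expn_gt0 //.
  exact: leq_ltn_trans (odd_bin_leq (hd k)) (ltn_ord _).
rewrite sum_nat_const card_ord; have : 0 < 2 ^ n by rewrite expn_gt0.
by move: lo; case: (2 ^ n) => // P; nia.
Qed.

Lemma num_reach_pred n K j : num_reach n K j.+1 <= num_reach n K j.
Proof.
apply: subset_leq_card; apply/subsetP => d; rewrite !inE.
by move=> /asboolP r; apply/asboolP; apply: reach_pred => // k; rewrite ltn_ord.
Qed.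

Lemma num_reach_le0 n K j : num_reach n K j <= num_reach n K 0.
Proof. by elim: j => // j; apply: leq_trans; apply: num_reach_pred. Qed.

Lemma card_pred_sum (T : finType) (P : pred T) : #|P| = \sum_x (P x : nat).
Proof.
rewrite -sum1_card big_mkcond; apply: eq_bigr => x _.
by rewrite unfold_in; case: (P x).
Qed.

(** Splits each coordinate below q = a b into a high part below a and a low part below b. The index
    type X allows the high parts to be given by a set of positions when a = 2. *)
Lemma sum_digits (X : finType) (v : X -> 'I_m -> nat) a b q
    (g : ('I_m -> nat) -> nat) :
  a * b = q -> 0 < q -> #|X| = a ^ m ->
  (forall x k, v x k < a) -> (forall x y, v x =1 v y -> x = y) ->
  \sum_(d : {ffun 'I_m -> 'I_q}) g (fun k => d k) =
  \sum_x \sum_(e : {ffun 'I_m -> 'I_b}) g (fun k => v x k * b + e k).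
Proof.
move=> abq q0 cX va vinj.
pose J (x : X * {ffun 'I_m -> 'I_b}) : {ffun 'I_m -> 'I_q} :=
  [ffun k => insubd (Ordinal q0) (v x.1 k * b + x.2 k)].
have JE x k : J x k = v x.1 k * b + x.2 k :> nat.
  rewrite ffunE val_insubd; case: ltnP => //; rewrite leqNgt => /negP; case.
  by have := va x.1 k; have := ltn_ord (x.2 k); nia.
have [J' JK KJ] : bijective J.
  apply: inj_card_bij => [[x e] [y f] /ffunP xy|]; last first.
    by rewrite card_prod !card_ffun !card_ord cX -expnMn abq.
  have vef k : v x k = v y k /\ e k = f k :> nat.
    have := congr1 val (xy k); rewrite /= !JE /= => E.
    have b0 : 0 < b by apply: leq_ltn_trans (ltn_ord (e k)).
    have := congr1 (divn^~ b) E; have := congr1 (modn^~ b) E.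
    by rewrite !modnMDl !divnMDl // !modn_small ?divn_small ?addn0.
  congr pair; first by apply: vinj => k; case: (vef k).
  by apply/ffunP => k; apply: val_inj; case: (vef k).
rewrite (reindex J) /=; last by exists J' => x _.
rewrite pair_bigA; apply: eq_bigr => x _; congr g.
by apply: funext => k; rewrite JE.
Qed.

(** By [reach_pred] it is best to use as many top digits as fit, so t is the minimum of #|S| and 2j
    + 1; the truncated subtraction is the carry that remains. *)
Lemma num_reachS n K j :
  num_reach n.+1 K j = \sum_(S : {set 'I_m}) num_reach n K (j.*2.+1 - #|S|).
Proof.
rewrite /num_reach card_pred_sum /=.
rewrite (sum_digits (v := fun (S : {set 'I_m}) k => k \in S : nat) (a := 2) (b := 2 ^ n)
  (fun d => `[< reach n.+1 K j d >])) ?expnS ?muln_gt0 ?expn_gt0 //; first last.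
- by move=> S S' SS'; apply/setP => k; have := SS' k; do 2!case: (_ \in _).
- by move=> S k; case: (_ \in _).
- by rewrite -cardsT -powersetT card_powerset cardsT card_ord.
apply: eq_bigr => S _; rewrite card_pred_sum; apply: eq_bigr => d _ /=.
congr nat_of_bool; apply: asbool_equiv_eq.
have dn k : d k < 2 ^ n by [].
rewrite reach_top //; split=> [[t [tS tj]]|r]; last first.
  have [Sj|jS] := leqP #|S| j.*2.+1; first by exists #|S|.
  exists j.*2.+1; rewrite subnn leqnn ltnW //; split=> //.
  by move: r; rewrite (eqP (ltnW jS)).
suff : forall u, reach n K (u + (j.*2.+1 - #|S|)) (fun k => d k) ->
    reach n K (j.*2.+1 - #|S|) (fun k => d k).
  move=> mono_u r; apply: (mono_u (j.*2.+1 - t - (j.*2.+1 - #|S|))).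
  by rewrite subnK // leq_sub2l.
by elim=> // u IH r; apply: IH; apply: reach_pred.
Qed.

(* Column c collects the sets S of top digits leading to state c. *)
Lemma num_reachS_matrix n K j : K < m ->
  num_reach n.+1 K j = \sum_(c < m) lambda_entry m j c * num_reach n K c.
Proof.
move=> Km; rewrite /lambda_entry num_reachS mul2n addn1.
transitivity (\sum_(S : {set 'I_m}) \sum_(c < m)
    (j.*2.+1 - #|S| == c) * num_reach n K c).
  apply: eq_bigr => S _; have [jm|mj] := ltnP (j.*2.+1 - #|S|) m.
    rewrite (bigD1 (Ordinal jm)) //= eqxx mul1n big1 ?addn0 // => c cj.
    by rewrite (_ : (_ == _) = false) //; apply/negbTE; rewrite eq_sym.
  rewrite num_reach_large // big1 // => c _.
  by rewrite (_ : (_ == _) = false) //; apply/eqP => cE; have := ltn_ord c; lia.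
rewrite exchange_big; apply: eq_bigr => c _ /=; rewrite -big_distrl /=.
congr (_ * _); case: (posnP c) => [->|c0].
  rewrite /bin_ge cardsE card_pred_sum; apply: eq_bigr => S _.
  by rewrite subn_eq0.
case: leqP => [cj|jc]; last first.
  by rewrite big1 // => S _; rewrite (_ : (_ == _) = false) //; apply/eqP; lia.
rewrite -[X in 'C(X, _)]card_ord -card_draws cardsE card_pred_sum.
apply: eq_bigr => S _ /=; congr nat_of_bool; rewrite -!/(#|_|).
by apply/eqP/eqP; lia.
Qed.

End Reach.

(** * From bad exponents to carries *)

Section CountBad.
Local Open Scope nat_scope.

(** Here q = N P, a sum is split into a high part H and a low part L, and c counts the subtractions
    of q - 1. Since c < m, the sum lies below (c + 1) q by at most P + m - 1, and L is at most m (P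
    - 1); dividing by P bounds H. *)
Lemma carry_bounds m N P c r H L : 1 < N -> 0 < P ->
  H * P + L <= m * (N * P).-1 -> L <= m * P.-1 ->
  H * P + L = c * (N * P).-1 + r -> r < N * P -> N * P - P <= r ->
  c.+1 * N <= H + m /\ H < c.+1 * N.
Proof.
move=> N1 P0 M_le L_le ME r_lt r_ge.
have cm : c < m.
  have : c * (N * P).-1 < m * (N * P).-1 by move: r_ge; nia.
  by rewrite ltn_mul2r => /andP[].
have mP : m * P = m * P.-1 + m by rewrite -{1}(prednK P0) mulnS addnC.
have NP0 : 0 < N * P by rewrite muln_gt0 P0 (ltnW N1).
have cNP : c * (N * P) = c * (N * P).-1 + c by rewrite -{1}(prednK NP0) mulnS addnC.
have PNP : P <= N * P by rewrite leq_pmull // ltnW.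
have SN : c.+1 * N * P = c * (N * P) + N * P by rewrite -mulnA mulSn addnC.
split; rewrite leqNgt; apply/negP => lt.
  have : (H + m).+1 * P <= c.+1 * N * P by rewrite leq_mul2r lt orbT.
  by rewrite SN mulSn mulnDl; lia.
have : c.+1 * N * P <= H * P by rewrite leq_mul2r -ltnS lt orbT.
by rewrite SN; lia.
Qed.

Variables (m l s : nat).
Hypotheses (m0 : 0 < m) (sl : s <= l).

(** The low blocks change the high sum needed by at most m, which gives the tolerance m - 1. The
    carry c forced by the reduction modulo q - 1 is lowered to 0 by [reach_pred]. *)
Lemma bad_reach (d e : 'I_m -> nat) :
  (forall k, d k < 2 ^ (l - s)) -> (forall k, e k < 2 ^ s) ->
  bad (2 ^ l) (2 ^ l - 2 ^ s) (fun k => d k * 2 ^ s + e k) ->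
  reach (l - s) m.-1 0 d.
Proof.
have lE : 2 ^ l = 2 ^ (l - s) * 2 ^ s by rewrite -expnD subnK.
have s0 : 0 < 2 ^ s by rewrite expn_gt0.
(* Without high digits [carry_bounds] does not apply, but the sum 0 already hits the target. *)
have [->|n0] := posnP (l - s) => dn en.
  move=> _; exists (fun=> 0); rewrite big1 // expn0; split=> // k.
  by rewrite bin0.
have n1 : 1 < 2 ^ (l - s) by rewrite (@ltn_exp2l 2 0).
move=> [i hi]; have iE k : i k = i k %/ 2 ^ s * 2 ^ s + i k %% 2 ^ s by apply: divn_eq.
have hE k : odd 'C(d k, i k %/ 2 ^ s) && odd 'C(e k, i k %% 2 ^ s).
  by rewrite -(odd_bin_split (n := s)) ?ltn_pmod // -iE.
have sE : \sum_k i k = (\sum_k i k %/ 2 ^ s) * 2 ^ s + \sum_k i k %% 2 ^ s.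
  by under eq_bigr do rewrite iE; rewrite big_split /= big_distrl.
have iq k : i k <= (2 ^ l).-1.
  have := odd_bin_leq (hi k); have := dn k; have := en k; rewrite lE; nia.
have sM : \sum_k i k <= m * (2 ^ l).-1.
  have : \sum_k i k <= \sum_(k < m) (2 ^ l).-1 by apply: leq_sum => k _; apply: iq.
  by rewrite sum_nat_const card_ord.
have sL : \sum_k i k %% 2 ^ s <= m * (2 ^ s).-1.
  have : \sum_k i k %% 2 ^ s <= \sum_(k < m) (2 ^ s).-1.
    by apply: leq_sum => k _; rewrite -ltnS prednK // ltn_pmod.
  by rewrite sum_nat_const card_ord.
have [c cE] := redexpE (2 ^ l) (\sum_k i k).
have rq : redexp (2 ^ l) (\sum_k i k) < 2 ^ l.
  by apply: redexp_lt; rewrite (@ltn_exp2l 2 0); lia.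
rewrite lE => rbig; rewrite sE lE in sM cE rq rbig.
have [lo hi'] := carry_bounds n1 s0 sM sL cE rq rbig.
suff : reach (l - s) m.-1 c d by elim: c {cE lo hi'} => // c IH /(reach_pred dn).
by exists (fun k => i k %/ 2 ^ s); split=> // [k|]; [case/andP: (hE k) | rewrite prednK].
Qed.

(** With all low digits of i equal to 0, the sum is exactly 2^l - 2^s, which needs no reduction. *)
Lemma reach_bad (d e : 'I_m -> nat) :
  (forall k, d k < 2 ^ (l - s)) -> (forall k, e k < 2 ^ s) ->
  reach (l - s) 0 0 d ->
  bad (2 ^ l) (2 ^ l - 2 ^ s) (fun k => d k * 2 ^ s + e k).
Proof.
move=> dn en [h [hd]]; rewrite !mul1n addn1 => lo hi.
have lE : 2 ^ l = 2 ^ (l - s) * 2 ^ s by rewrite -expnD subnK.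
have s0 : 0 < 2 ^ s by rewrite expn_gt0.
exists (fun k => h k * 2 ^ s) => [k|].
  by rewrite -[h k * _]addn0 odd_bin_split // hd bin0.
rewrite -big_distrl /= redexp_small ?lE ?ltn_pmul2r //.
by rewrite leq_subLR -mulSn leq_mul2r lo orbT.
Qed.

Lemma num_badE : num_bad (2 ^ l) (2 ^ l - 2 ^ s) m =
  \sum_(d : {ffun 'I_m -> 'I_(2 ^ (l - s))}) \sum_(e : {ffun 'I_m -> 'I_(2 ^ s)})
     `[< bad (2 ^ l) (2 ^ l - 2 ^ s) (fun k => d k * 2 ^ s + e k) >].
Proof.
rewrite /num_bad card_pred_sum /=.
apply: (sum_digits (v := fun (d : {ffun 'I_m -> 'I_(2 ^ (l - s))}) k => d k : nat)
  (a := 2 ^ (l - s)) (fun d => `[< bad (2 ^ l) (2 ^ l - 2 ^ s) d >] : nat)).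
- by rewrite -expnD subnK.
- by rewrite expn_gt0.
- by rewrite card_ffun !card_ord.
- by [].
- by move=> d d' dd'; apply/ffunP => k; apply: val_inj; apply: dd'.
Qed.

Lemma num_bad_leq :
  num_bad (2 ^ l) (2 ^ l - 2 ^ s) m <= num_reach m (l - s) m.-1 0 * (2 ^ s) ^ m.
Proof.
rewrite num_badE /num_reach card_pred_sum big_distrl; apply: leq_sum => d _ /=.
case: asboolP => [_|nr].
  rewrite mul1n -[X in _ <= _ ^ X]card_ord -[X in _ <= X ^ _]card_ord -card_ffun.
  rewrite -sum1_card; apply: leq_sum => e _; exact: leq_b1.
rewrite big1 // => e _; case: asboolP => // b; case: nr.
by apply: bad_reach b => k; rewrite ltn_ord.
Qed.

Lemma num_bad_geq :
  num_reach m (l - s) 0 0 * (2 ^ s) ^ m <= num_bad (2 ^ l) (2 ^ l - 2 ^ s) m.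
Proof.
rewrite num_badE /num_reach card_pred_sum big_distrl; apply: leq_sum => d _ /=.
case: asboolP => // r.
rewrite mul1n -[X in _ ^ X <= _]card_ord -[X in X ^ _ <= _]card_ord -card_ffun.
rewrite -sum1_card; apply: leq_sum => e _; case: asboolP => // nb; case: nb.
by apply: reach_bad r => k; rewrite ltn_ord.
Qed.

End CountBad.

(** Used to squeeze r between consecutive powers of two. *)
Lemma leq_num_bad q e0 e1 m : (e0 <= e1)%N -> (num_bad q e1 m <= num_bad q e0 m)%N.
Proof.
move=> e01; apply: subset_leq_card; apply/subsetP => d; rewrite !inE.
move=> /asboolP[i hi ei]; apply/asboolP; exists i => //; exact: leq_trans ei.
Qed.

(** * Perron-Frobenius *)

Section Perron.
Import classical_sets topology normedtype derive.
Import numFieldNormedType.Exports.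
Local Open Scope classical_set_scope.
Variable R : realType.

Lemma mulmx_gt0 n (v : 'rV[R]_n) (B : 'M[R]_n) :
  (forall j, 0 <= v 0 j) -> v != 0 -> (forall i j, 0 < B i j) ->
  forall j, 0 < (v *m B) 0 j.
Proof.
move=> v0 vN0 B0 j; have [i vi] : exists i, v 0 i != 0.
  apply/existsP; apply: contraNT vN0; rewrite negb_exists => /forallP h.
  by apply/eqP/rowP => i; rewrite mxE; apply/eqP; move: (h i); rewrite negbK.
rewrite mxE (bigD1 i) //= ltr_wpDr ?sumr_ge0 // => [k _|].
  by rewrite mulr_ge0 // ltW.
by rewrite mulr_gt0 // lt_neqAle eq_sym vi v0.
Qed.

Lemma exists_scale_le n (a b : 'I_n -> R) :
  (forall j, 0 < a j) -> (forall j, 0 < b j) ->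
  exists2 e, 0 < e & forall j, e * b j <= a j.
Proof.
move=> a0 b0; pose s := 1 + \sum_j b j / a j.
have ba j : 0 <= b j / a j by rewrite divr_ge0 // ltW.
have s0 : 0 < s by rewrite ltr_wpDr ?sumr_ge0.
exists s^-1 => [|j]; first by rewrite invr_gt0.
rewrite mulrC ler_pdivrMr // -ler_pdivrMl // mulrC /s (bigD1 j) //= addrCA lerDl.
by rewrite addr_ge0 ?sumr_ge0.
Qed.

(* Coordinate 0 of y is t and the others form x, with x in the simplex and
   t x <= x B. *)
Definition collatz n (B : 'M[R]_n) : set ('rV[R]_n.+1) :=
  [set y | [/\ forall j, 0 <= y 0 (lift ord0 j), \sum_j y 0 (lift ord0 j) = 1,
    0 <= y 0 ord0 & forall j,
    y 0 ord0 * y 0 (lift ord0 j) <= \sum_i y 0 (lift ord0 i) * B i j]].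

(** Summing t x <= x B over all coordinates, with the x_j of sum 1, bounds t by the sum of the
    entries of B. *)
Lemma collatz_le n (B : 'M[R]_n) y : (forall i j, 0 <= B i j) ->
  collatz B y -> forall k, 0 <= y 0 k <= 1 + \sum_j \sum_i B i j.
Proof.
move=> B0 [y0 y1 t0 yB] k.
have S0 : 0 <= \sum_j \sum_i B i j.
  by apply: sumr_ge0 => j _; apply: sumr_ge0 => i _; apply: B0.
have yle1 i : y 0 (lift ord0 i) <= 1.
  by rewrite -y1 (bigD1 i) //= lerDl sumr_ge0.
case: (unliftP ord0 k) => [j|] ->.
  by rewrite y0 (le_trans (yle1 _)) // lerDl.
rewrite t0 /=; apply: (@le_trans _ _ (y 0 ord0 * 1)); first by rewrite mulr1.
rewrite -[X in _ * X <= _]y1 mulr_sumr.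
apply: (@le_trans _ _ (\sum_j \sum_i B i j)); last by rewrite lerDr.
apply: ler_sum => j _; apply: le_trans (yB j) _.
by apply: ler_sum => i _; rewrite ler_piMl.
Qed.

Lemma collatz_compact n (B : 'M[R]_n) : (forall i j, 0 <= B i j) ->
  compact (collatz B).
Proof.
move=> B0; have coordc k : continuous (fun y : 'rV[R]_n.+1 => y 0 k).
  by move=> y; apply: coord_continuous.
apply: (@subclosed_compact _ _ [set y : 'rV[R]_n.+1 |
    forall k, `[0, 1 + \sum_j \sum_i B i j]%classic (y ord0 k)]); first last.
- by move=> y yB k; rewrite /= in_itv /=; apply: collatz_le.
- apply: (@rV_compact _ n.+1 (fun=> `[0, 1 + \sum_j \sum_i B i j]%classic)) => k.
  exact: segment_compact.
have sumc (g : 'I_n -> 'rV[R]_n.+1 -> R) :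
    (forall i, continuous (g i)) -> continuous (fun y => \sum_i g i y).
  move=> gc; apply: (@continuous_big _ _ +%R 0 xpredT _ _ _ g) => [|i _].
    exact: add_continuous.
  exact: gc.
pose f j (y : 'rV[R]_n.+1) :=
  \sum_i y 0 (lift ord0 i) * B i j - y 0 ord0 * y 0 (lift ord0 j).
have mulc (g h : 'rV[R]_n.+1 -> R) : continuous g -> continuous h ->
    continuous (fun y => g y * h y).
  by move=> gc hc y; apply: (@continuousM R _ g h); [exact: gc|exact: hc].
have subc (g h : 'rV[R]_n.+1 -> R) : continuous g -> continuous h ->
    continuous (fun y => g y - h y).
  by move=> gc hc y; apply: (@continuousB R R _ g h); [exact: gc|exact: hc].
have fc j : continuous (f j).
  apply: (subc (fun y => \sum_i y 0 (lift ord0 i) * B i j)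
    (fun y => y 0 ord0 * y 0 (lift ord0 j))).
    apply: (sumc (fun i y => y 0 (lift ord0 i) * B i j)) => i.
    apply: (mulc (fun y => y 0 (lift ord0 i)) (fun=> B i j)); first exact: coordc.
    by move=> z; exact: cst_continuous.
  by apply: (mulc (fun y => y 0 ord0) (fun y => y 0 (lift ord0 j))); exact: coordc.
have -> : collatz B =
    (\bigcap_(k in [set: 'I_n.+1])
      ((fun y : 'rV[R]_n.+1 => y 0 k) @^-1` [set x | 0 <= x]))
    `&` (((fun y : 'rV[R]_n.+1 => \sum_j y 0 (lift ord0 j)) @^-1` [set x | x = 1])
    `&` (\bigcap_(j in [set: 'I_n]) (f j @^-1` [set x | 0 <= x]))).
  apply/seteqP; split=> y.
    move=> [y0 y1 t0 yB]; split; last split=> // j _ /=.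
      by move=> k _ /=; have [j ->|->] := unliftP ord0 k.
    by rewrite /f subr_ge0.
  move=> [y0 [y1 yB]]; split=> // [j||j]; [exact: y0|exact: y0|].
  by rewrite -subr_ge0; apply: (yB j).
apply: closedI; last apply: closedI.
- apply: closed_bigI => k _; apply: preimage_closed (@closed_ge _ _) => y _.
  exact: coordc.
- apply: preimage_closed (@closed_eq _ _) => y _.
  by apply: (sumc (fun j y => y 0 (lift ord0 j))) => j; exact: coordc.
- apply: closed_bigI => j _; apply: preimage_closed (@closed_ge _ _) => y _.
  exact: fc.
Qed.

Lemma collatz_row n (B : 'M[R]_n) (x : 'rV[R]_n) t :
  (forall j, 0 <= x 0 j) -> x != 0 -> 0 <= t ->
  (forall j, t * x 0 j <= (x *m B) 0 j) ->
  exists2 y, collatz B y & y 0 ord0 = t.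
Proof.
move=> x0 xN0 t0 xB; pose s := \sum_j x 0 j.
have s0 : 0 < s.
  rewrite lt_neqAle sumr_ge0 // andbT eq_sym; apply: contraNN xN0 => /eqP sE.
  apply/eqP/rowP => j; rewrite mxE; apply/eqP; move/eqP: sE.
  by rewrite psumr_eq0 // => /allP/(_ j (mem_index_enum _)).
exists (\row_k oapp (fun j => x 0 j / s) t (unlift ord0 k)); last first.
  by rewrite mxE unlift_none.
split=> [j|||j]; rewrite ?mxE ?unlift_none ?liftK //=.
- by rewrite divr_ge0 // ltW.
- by under eq_bigr do rewrite mxE liftK /=; rewrite -mulr_suml divff // gt_eqF.
- under eq_bigr do rewrite mxE liftK /= mulrAC.
  by rewrite -mulr_suml mulrA ler_pM2r ?invr_gt0 //; move: (xB j); rewrite mxE.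
Qed.

(* The left eigenvalue is the largest t with t x <= x B for some x >= 0, x <> 0:
   if the inequality were not an equality, multiplying by the positive power of
   B would make it strict in every coordinate and t could be increased. *)
Lemma perron n (B : 'M[R]_n.+1) K :
  (forall i j, 0 <= B i j) -> (forall i j, 0 < (B ^+ K) i j) ->
  exists (rho : R) (u : 'rV[R]_n.+1),
    (forall j, 0 < u 0 j) /\ u *m B = rho *: u.
Proof.
move=> B0 BK.
have [] := @compact_EVT_max _ _ (fun y : 'rV[R]_n.+2 => y 0 ord0) (collatz B).
- have [|||j|y yB _] := @collatz_row _ B (const_mx 1) 0; last by exists y.
  + by move=> j; rewrite mxE.
  + by apply/eqP => /rowP/(_ ord0)/eqP; rewrite !mxE oner_eq0.
  + by [].
  + by rewrite mul0r mxE sumr_ge0 // => i _; rewrite mxE mul1r.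
- exact: collatz_compact.
- by apply: continuous_subspaceT => y; apply: coord_continuous.
move=> y; rewrite inE => -[y0 y1 t0 yB] ymax; set t := y 0 ord0 in t0 yB ymax.
pose x : 'rV[R]_n.+1 := \row_j y 0 (lift ord0 j).
have x0 j : 0 <= x 0 j by rewrite mxE.
have xN0 : x != 0.
  apply/eqP => x_0; move/eqP: y1; rewrite big1 => [|j _].
    by rewrite eq_sym oner_eq0.
  by move/rowP/(_ j) : x_0; rewrite !mxE.
have xBt j : t * x 0 j <= (x *m B) 0 j.
  by rewrite !mxE; under eq_bigr do rewrite mxE; apply: yB.
have xBK : forall j, 0 < (x *m B ^+ K) 0 j by apply: mulmx_gt0.
have subE (v w : 'rV[R]_n.+1) j : (v - t *: w) 0 j = v 0 j - t * w 0 j.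
  by rewrite !mxE.
have BBK : B *m B ^+ K = B ^+ K *m B.
  by rewrite [LHS](_ : _ = B * B ^+ K) // [RHS](_ : _ = B ^+ K * B) // -exprS exprSr.
have xE : x *m B = t *: x.
  apply/eqP; rewrite -subr_eq0; apply: contraT => zN0.
  have z0 j : 0 <= (x *m B - t *: x) 0 j by rewrite subE subr_ge0.
  (* Multiplied by B^K, the nonzero slack z = x B - t x dominates e x B^K, so x B^K is admissible
     for t + e, against the maximality of t. *)
  have [e e0 ezx] := exists_scale_le (mulmx_gt0 z0 zN0 BK) xBK.
  have xKN0 : x *m B ^+ K != 0.
    apply/eqP => /rowP/(_ ord0) xK0.
    by have := xBK ord0; rewrite xK0 mxE ltxx.
  have [||j|y' y'B y't] := @collatz_row _ B (x *m B ^+ K) (t + e) _ xKN0.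
  - by move=> j; apply: ltW.
  - by rewrite addr_ge0 // ltW.
  - have := ezx j; rewrite mulmxBl -mulmxA -BBK mulmxA -scalemxAl.
    by rewrite subE lerBrDr -mulrDl addrC.
  by have := ymax y'; rewrite inE => /(_ y'B); rewrite y't gerDl leNgt e0.
exists t, x; split=> // j; rewrite lt_neqAle x0 andbT eq_sym.
(* A zero coordinate of x would stay zero in x B^K = t^K x, which is positive. *)
have xK k : x *m B ^+ k = t ^+ k *: x.
  elim: k => [|k IH]; first by rewrite !expr0 scale1r; apply: mulmx1.
  by rewrite !exprS mulmxA xE -scalemxAl IH scalerA.
by apply/eqP => xj; have := xBK j; rewrite xK mxE xj mulr0 ltxx.
Qed.

(* A left eigenvector w is dominated by c u with equality at some coordinate;
   comparing w A with c u A there bounds its eigenvalue. *)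
Lemma eigenvalue_le n (A : 'M[R]_n) (u : 'rV[R]_n) rho a :
  (forall i j, 0 <= A i j) -> (forall j, 0 < u 0 j) -> u *m A = rho *: u ->
  eigenvalue A a -> a <= rho.
Proof.
move=> A0 u0 uA /eigenvalueP[w wA wN0].
have [i0 wi0] : exists i, w 0 i != 0.
  apply/existsP; apply: contraNT wN0; rewrite negb_exists => /forallP h.
  by apply/eqP/rowP => i; rewrite mxE; apply/eqP; move: (h i); rewrite negbK.
have [i _ imax] := arg_maxP (fun i => `|w 0 i| / u 0 i) (erefl : xpredT i0).
set c := `|w 0 i| / u 0 i.
have wc j : `|w 0 j| <= c * u 0 j by rewrite -ler_pdivrMr //; apply: imax.
have c0 : 0 < c.
  by apply: lt_le_trans (imax i0 isT); rewrite divr_gt0 ?normr_gt0.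
have wi : `|w 0 i| = c * u 0 i by rewrite /c divfK // gt_eqF.
suff : `|a| * (c * u 0 i) <= rho * (c * u 0 i).
  rewrite ler_pM2r; last by rewrite mulr_gt0.
  exact: le_trans (ler_norm a).
have := congr1 (fun M : 'rV[R]_n => M 0 i) wA; rewrite [in RHS]mxE => wAi.
have := congr1 (fun M : 'rV[R]_n => M 0 i) uA; rewrite [in RHS]mxE => uAi.
rewrite -{1}wi -normrM -wAi mulrCA -uAi !mxE mulr_sumr.
apply: le_trans (ler_norm_sum _ _ _) _; apply: ler_sum => k _.
by rewrite normrM (ger0_norm (A0 _ _)) mulrA ler_wpM2r.
Qed.

End Perron.

(** * The largest eigenvalue of A_m *)

Lemma bin_ge1 m : bin_ge m 1 = (2 ^ m).-1.
Proof.
rewrite /bin_ge (_ : [set S | _] = [set~ set0]); last first.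
  by apply/setP => S; rewrite !inE card_gt0.
by rewrite cardsC1 -cardsT -powersetT card_powerset cardsT card_ord.
Qed.

Lemma bin_ge_gt0 m a : (0 < bin_ge m a)%N = (a <= m)%N.
Proof.
apply/card_gt0P/idP => [[S]|am]; last by exists setT; rewrite inE cardsT card_ord.
by rewrite inE => /leq_trans; apply; rewrite -[leqRHS]card_ord max_card.
Qed.

(** Positivity next to the diagonal, outside the last row, makes the corresponding block of A_m
    irreducible. *)
Lemma lambda_entry_gt0 m j c : (j.+1 < m)%N -> (j <= c.+1)%N -> (c <= j.+1)%N ->
  (0 < lambda_entry m j c)%N.
Proof.
move=> jm jc cj; rewrite /lambda_entry; case: eqP => [c0|].
  by rewrite bin_ge_gt0; lia.
by rewrite (_ : (c <= _)%N) ?bin_gt0; lia.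
Qed.

(** From carry m - 1 with |S| top digits set, the next carry 2m - 1 - |S| is at least m - 1, with
    equality only for the full set. *)
Lemma lambda_entry_last n c : (c <= n)%N -> lambda_entry n.+1 n c = (c == n).
Proof.
move=> cn; rewrite /lambda_entry; case: eqP => [->|c0].
  case: n {cn} => [|n]; first by rewrite bin_ge1.
  by apply/eqP; rewrite -leqn0 leqNgt bin_ge_gt0; lia.
rewrite (_ : (c <= _)%N); last by lia.
have [->|cN] := eqVneq c n.
  by rewrite (_ : _ - n = n.+1)%N ?binn //; lia.
by rewrite bin_small //; lia.
Qed.

Section Spectrum.
Import classical_sets.
Variable R : realType.

Lemma lambda_mxE m (i j : 'I_m) : lambda_mx R m i j = (lambda_entry m i j)%:R.
Proof. by rewrite mxE. Qed.

(** A positive left eigenvector certifies its eigenvalue as the largest, by [eigenvalue_le]. *)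
Lemma lambdaE n (u : 'rV[R]_n.+1) rho : (forall j, 0 < u 0 j) ->
  u *m lambda_mx R n.+1 = rho *: u -> lambda R n.+1 = rho.
Proof.
move=> u0 uA.
have ev : eigenvalue (lambda_mx R n.+1) rho.
  apply/eigenvalueP; exists u => //; apply/eqP => /rowP/(_ ord0) uE.
  by have := u0 ord0; rewrite uE mxE ltxx.
have ub a : eigenvalue (lambda_mx R n.+1) a -> a <= rho.
  by apply: eigenvalue_le u0 uA => i j; rewrite lambda_mxE.
apply/eqP; rewrite eq_le; apply/andP; split.
  by apply: ge_sup => [|a]; [exists rho | apply: ub].
by apply: ub_le_sup => //; exists rho => a; apply: ub.
Qed.

(** A walk from i to j moves by at most one index at a time, and every such step has positive
    weight. *)
Lemma pow_band_gt0 n (B : 'M[R]_n.+1) k : (forall i j, 0 <= B i j) ->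
  (forall i j : 'I_n.+1, (i <= j.+1)%N -> (j <= i.+1)%N -> 0 < B i j) ->
  forall i j : 'I_n.+1, (i <= j + k)%N -> (j <= i + k)%N -> 0 < (B ^+ k) i j.
Proof.
move=> B0 band; have BX0 k' i j : 0 <= (B ^+ k') i j.
  elim: k' i j => [|k' IH] i j; first by rewrite expr0 mxE.
  by rewrite exprS mxE sumr_ge0 // => l _; rewrite mulr_ge0.
elim: k => [|k IH] i j ij ji.
  by rewrite expr0 mxE (_ : i == j) // -val_eqE /= eqn_leq; lia.
have [l [il li lj jl]] : exists l : 'I_n.+1,
    [/\ (i <= l.+1)%N, (l <= i.+1)%N, (l <= j + k)%N & (j <= l + k)%N].
  have [lt|gt|eq] := ltngtP i j.
  - by exists (inord i.+1); rewrite inordK ?(leq_ltn_trans lt) //; split; lia.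
  - exists (inord i.-1); rewrite inordK ?(leq_ltn_trans (leq_pred _)) //.
    by split; lia.
  - by exists i; split; lia.
rewrite exprS mxE (bigD1 l) //= ltr_wpDr ?sumr_ge0 // => [l' _|].
  by rewrite mulr_ge0.
by rewrite mulr_gt0 ?band ?IH.
Qed.

(* The last row of the matrix is the last unit row, so an eigenvector of the
   irreducible block on the other indices, of eigenvalue rho > 1, extends. *)
Lemma lambda_mx_perron n : exists u : 'rV[R]_n.+1,
  [/\ forall j, 0 < u 0 j,
      u *m lambda_mx R n.+1 = lambda R n.+1 *: u & 1 <= lambda R n.+1].
Proof.
case: n => [|n].
  have A1 : lambda_mx R 1 = 1%:M.
    by apply/matrixP => i j; rewrite lambda_mxE !ord1 mxE lambda_entry_last.
  have u0 j : 0 < (const_mx 1 : 'rV[R]_1) 0 j by rewrite mxE.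
  have uA : (const_mx 1 : 'rV[R]_1) *m lambda_mx R 1 = 1 *: const_mx 1.
    by rewrite A1 mulmx1 scale1r.
  by exists (const_mx 1); rewrite (lambdaE u0 uA).
pose a i j : R := (lambda_entry n.+2 i j)%:R.
pose B : 'M[R]_n.+1 := \matrix_(i, j) a i j.
have B0 i j : 0 <= B i j by rewrite mxE ler0n.
have BK (i j : 'I_n.+1) : 0 < (B ^+ n.+1) i j.
  apply: pow_band_gt0 => // [i' j' ij ji||].
  - by rewrite mxE ltr0n lambda_entry_gt0 // ltnS ltn_ord.
  - by have := ltn_ord i; lia.
  - by have := ltn_ord j; lia.
have [rho [u [u0 uB]]] := perron B0 BK.
have uBE (j : 'I_n.+1) : \sum_i u 0 i * a i j = rho * u 0 j.
  have := congr1 (fun M : 'rV[R]_n.+1 => M 0 j) uB; rewrite !mxE => <-.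
  by apply: eq_bigr => i _; rewrite mxE.
(* The corner entry is 2^m - 1 with m >= 2, so rho - 1 can be inverted below. *)
have rho3 : 3 <= rho.
  rewrite -(ler_pM2r (u0 ord0)) -uBE (bigD1 ord0) //= mulrC.
  rewrite (@le_trans _ _ (u 0 ord0 * a 0 0)) //.
    rewrite ler_pM2l // ler_nat /lambda_entry /= bin_ge1 !expnS.
    by have : (0 < 2 ^ n)%N; [rewrite expn_gt0 | lia].
  by rewrite lerDl sumr_ge0 // => i _; rewrite mulr_ge0 ?ler0n // ltW.
(* The last coordinate of the extended eigenvector solves sum_i u_i a_(i, m-1) + s = rho s. *)
pose s := (\sum_(i < n.+1) u 0 i * a i n.+1) / (rho - 1).
have s0 : 0 < s.
  rewrite divr_gt0 //; last by rewrite subr_gt0 (lt_le_trans _ rho3) // ltr1n.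
  rewrite (bigD1 ord_max) //= ltr_wpDr ?sumr_ge0 // => [i _|].
    by rewrite mulr_ge0 ?ler0n // ltW.
  by rewrite mulr_gt0 // ltr0n; apply: lambda_entry_gt0 => /=; lia.
pose v : 'rV[R]_n.+2 := \row_j (if (j < n.+1)%N then u 0 (inord j) else s).
have vw (i : 'I_n.+1) : v 0 (widen_ord (leqnSn _) i) = u 0 i.
  by rewrite mxE /= ltn_ord inord_val.
have vm : v 0 ord_max = s by rewrite mxE ltnn.
have v0 j : 0 < v 0 j by rewrite mxE; case: ifP.
have vA : v *m lambda_mx R n.+2 = rho *: v.
  apply/rowP => j; rewrite [LHS]mxE [RHS]mxE big_ord_recr /= vm lambda_mxE.
  under eq_bigr do rewrite vw lambda_mxE /=.
  have [jn|nj] := ltnP j n.+1.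
    rewrite lambda_entry_last ?(ltnW jn) // (ltn_eqF jn) mulr0 addr0.
    rewrite (uBE (Ordinal jn)) mxE jn; congr (_ * u 0 _).
    by apply: val_inj; rewrite /= inordK.
  have -> : j = ord_max by apply: val_inj; apply/eqP; rewrite eqn_leq nj -ltnS ltn_ord.
  rewrite vm lambda_entry_last // eqxx mulr1.
  have -> : \sum_(i < n.+1) u 0 i * (lambda_entry n.+2 i n.+1)%:R = s * (rho - 1).
    by rewrite /s divfK // subr_eq0 gt_eqF // (lt_le_trans _ rho3) // ltr1n.
  by ring.
exists v; rewrite (lambdaE v0 vA); split=> //.
by apply: le_trans rho3; rewrite ler1n.
Qed.

(** One more digit multiplies the column of counts by A_m, hence its pairing with a left eigenvector
    by rho. *)
Lemma num_reach_eigen m (u : 'rV[R]_m) rho n K : (K < m)%N ->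
  u *m lambda_mx R m = rho *: u ->
  \sum_j u 0 j * (num_reach m n K j)%:R
  = rho ^+ n * \sum_j u 0 j * (num_reach m 0 K j)%:R.
Proof.
move=> Km uA; elim: n => [|n IH]; first by rewrite mul1r.
rewrite exprS -mulrA -IH mulr_sumr.
under eq_bigr do rewrite num_reachS_matrix // natr_sum mulr_sumr.
rewrite exchange_big; apply: eq_bigr => c _ /=.
have := congr1 (fun M : 'rV[R]_m => M 0 c) uA; rewrite !mxE mulrA => <-.
rewrite mulr_suml; apply: eq_bigr => j _.
by rewrite mxE natrM mulrA.
Qed.

(** The pairing of u with the counts is at least u_0 times the count of state 0 and at most S times
    it, state 0 having the largest count. With no digits it lies between u_0 and S, so S / u_0
    serves for both bounds. *)
Lemma num_reach_bounds n : exists2 c : R, 0 < c & forall k,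
  (num_reach n.+1 k n 0)%:R <= c * lambda R n.+1 ^+ k /\
  lambda R n.+1 ^+ k <= c * (num_reach n.+1 k 0 0)%:R.
Proof.
have [u [u0 uA l1]] := lambda_mx_perron n.
set rho := lambda R n.+1 in uA l1 *.
pose S := \sum_j u 0 j.
have S0 : 0 < S by rewrite /S (bigD1 ord0) //= ltr_wpDr ?sumr_ge0 // => j _; rewrite ltW.
have rk k : 0 <= rho ^+ k by rewrite exprn_ge0 // (le_trans ler01).
exists (S / u 0 ord0) => [|k]; first by rewrite divr_gt0.
rewrite ![S / _ * _]mulrAC ler_pdivlMr // ler_pdivlMr //; split.
  apply: (@le_trans _ _ (\sum_j u 0 j * (num_reach n.+1 k n j)%:R)).
    rewrite (bigD1 ord0) //= mulrC lerDl sumr_ge0 // => j _.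
    by rewrite mulr_ge0 ?ler0n // ltW.
  rewrite (num_reach_eigen _ _ uA) // mulrC ler_wpM2r //.
  apply: ler_sum => j _; rewrite num_reach0 -[leRHS]mulr1 ler_wpM2l ?(ltW (u0 _)) //.
  by rewrite lern1 leq_b1.
apply: (@le_trans _ _ (\sum_j u 0 j * (num_reach n.+1 k 0 j)%:R)).
  rewrite (num_reach_eigen _ _ uA) // ler_wpM2l // (bigD1 ord0) //=.
  rewrite num_reach0 mulr1 lerDl sumr_ge0 // => j _.
  by rewrite mulr_ge0 ?ler0n // ltW.
rewrite /S mulr_suml; apply: ler_sum => j _.
by rewrite ler_wpM2l ?(ltW (u0 _)) // ler_nat num_reach_le0.
Qed.

End Spectrum.

(** * The batch property *)

(** A generator matrix has \dim C independent columns; inverting the square block they form makes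
    the positions [p i] carry the message symbols. *)
Lemma systematic_encoding (F : finFieldType) (I : finType) (C : code F I) :
  exists (enc : 'rV[F]_(\dim C) -> {ffun I -> F^o}) (p : 'I_(\dim C) -> I),
    (forall y, y \in C <-> exists x, y = enc x) /\
    (forall x i, enc x (p i) = x 0 i).
Proof.
set n := \dim C; pose b := vbasis C.
pose G : 'M[F]_(n, #|I|) := \matrix_(i, k) b`_i (enum_val k).
have freeb : free b := basis_free (vbasisP C).
have Gfree : row_free G.
  apply: inj_row_free => v vG; apply/rowP => i; rewrite mxE.
  have /freeP fb := freeb; apply: (fb (fun i => v 0 i)); apply/ffunP => k.
  have := congr1 (fun M : 'rV[F]_#|I| => M 0 (enum_rank k)) vG.
  rewrite !mxE ffunE sum_ffunE => vGk; rewrite -[RHS]vGk.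
  by apply: eq_bigr => j _; rewrite ffunE mxE enum_rankK.
have Gfull : row_full G^T by rewrite /row_full mxrank_tr.
pose p (i : 'I_n) : I := enum_val (fullrankfun Gfull i).
pose M := (rowsub (fullrankfun Gfull) G^T)^T.
have Mu : M \in unitmx by rewrite unitmx_tr fullrowsub_unit.
pose enc (x : 'rV[F]_n) := \sum_i (x *m invmx M) 0 i *: b`_i.
exists enc, p; split=> [y|x i]; last first.
  rewrite -[in RHS](mulmxKV Mu x) [RHS]mxE sum_ffunE.
  by apply: eq_bigr => j _; rewrite ffunE !mxE.
split=> [yC|[x ->]].
  exists ((\row_i coord b i y) *m M); rewrite /enc mulmxK // {1}(coord_vbasis yC).
  by apply: eq_bigr => i _; rewrite mxE.
by apply: memv_suml => i _; rewrite memvZ // vbasis_mem // mem_nth // size_tuple.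
Qed.

Lemma greedy_disjoint (T : finType) (good : nat -> {set T} -> Prop) d k :
  (forall j X, good j X -> #|X| <= d)%N ->
  (forall j (used : {set T}), j < k -> #|used| <= j * d ->
     exists2 X, good j X & [disjoint X & used])%N ->
  exists S : nat -> {set T}, (forall j, (j < k)%N -> good j (S j)) /\
    (forall i j, (i < j < k)%N -> [disjoint S i & S j]).
Proof.
move=> goodd step.
(* The induction carries a set [used] that contains all choices made so far and obeys the size
   bound. *)
suff: exists (S : nat -> {set T}) (used : {set T}),
    [/\ forall j, (j < k)%N -> good j (S j) /\ S j \subset used,
        forall i j, (i < j < k)%N -> [disjoint S i & S j] & (#|used| <= k * d)%N].
  by move=> [S [used [Sg Sd _]]]; exists S; split=> // j /Sg[].
elim: k step => [|k IH] step.
  by exists (fun=> set0), set0; split=> //; [move=> i j; rewrite andbF | rewrite cards0].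
have [|S [used [Sg Sd Su]]] := IH; first by move=> j used jk; apply: step; apply: leqW.
have [X Xg Xu] := step k used (leqnn _) Su.
exists (fun j => if j == k then X else S j), (used :|: X); split=> [j||].
- rewrite ltnS leq_eqVlt; case: eqP => [->|_] /=; first by rewrite subsetUr.
  by move=> /Sg[gj sj]; split=> //; apply: subset_trans sj (subsetUl _ _).
- move=> i j /andP[ij]; rewrite ltnS leq_eqVlt => jk.
  have ik : (i < k)%N by apply: leq_trans ij _; case/orP: jk => [/eqP->|/ltnW].
  rewrite (ltn_eqF ik); case: eqP jk => /= [_ _|_ jk]; last by rewrite Sd ?ij.
  rewrite disjoint_sym; apply: disjointWr Xu; exact: (Sg i ik).2.
apply: leq_trans (leq_card_setU _ _) _.
by rewrite mulSn addnC leq_add // (goodd k).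
Qed.

(** With Q = q^(m-1), this is the hypothesis of [exists_direction]: u <= j q < Q r, and (q Q - 1) r
    is at least (q - 1) Q r. *)
Lemma used_bound q Q r j u : (1 <= r < q)%N -> (0 < Q)%N ->
  (u <= j * (q - r))%N -> (j * q < Q * r)%N -> (q.-1 * u < (q * Q).-1 * r)%N.
Proof.
move=> /andP[r1 rq] Q0 uj jq.
have uQ : (u < Q * r)%N.
  by apply: leq_ltn_trans uj (leq_ltn_trans _ jq); rewrite leq_mul2l leq_subr orbT.
case: q rq {uj jq} => // p; rewrite ltnS => rp /=.
have : (p * u + p <= p * (Q * r))%N by rewrite -mulnSr leq_mul2l uQ orbT.
have Qr0 : (0 < Q * r)%N by rewrite muln_gt0 Q0.
have -> : ((p.+1 * Q).-1 * r = p * (Q * r) + Q * r - r)%N.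
  by rewrite -subn1 mulnBl mul1n mulSn mulnDl -mulnA addnC.
have : (r <= Q * r)%N by rewrite leq_pmull.
by lia.
Qed.

Section Recovery.
Variables (F : finFieldType) (m : nat).

(** The parameter 0 is left out because the point p itself may already be in use. *)
Definition hits (used : {set 'rV[F]_m}) (p v : 'rV[F]_m) : {set F} :=
  [set t | (t != 0) && (t *: v + p \in used)].

(* Averaging over all directions v, each point of [used] being hit once for
   every nonzero t. *)
Lemma exists_direction (used : {set 'rV[F]_m}) (p : 'rV[F]_m) r :
  (#|F|.-1 * #|used| < (#|F| ^ m).-1 * r)%N ->
  exists v, (#|hits used p v| < r)%N.
Proof.
move=> h; apply/existsP; apply: contraLR h => /existsPn h; rewrite -leqNgt.
pose N (v : 'rV[F]_m) (t : F) : nat := t *: v + p \in used.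
apply: (@leq_trans (\sum_(v | v != 0%R) \sum_(t | t != 0%R) N v t)%N).
  rewrite (_ : (#|F| ^ m).-1 = #|[pred v : 'rV[F]_m | v != 0%R]|); last first.
    by rewrite (cardC1 (0%R : 'rV[F]_m)) card_mx mul1n.
  rewrite -sum_nat_const; apply: leq_sum => v _.
  have := h v; rewrite -leqNgt => /leq_trans; apply.
  rewrite -sum1_card big_mkcond [leqRHS]big_mkcond; apply: leq_sum => t _.
  by rewrite inE /N; case: (t != 0); case: (_ \in _).
rewrite exchange_big (_ : #|F|.-1 = #|[pred t : F | t != 0%R]|); last first.
  by rewrite (cardC1 (0%R : F)).
rewrite -sum_nat_const; apply: leq_sum => t t0 /=.
have tinj : injective (fun v => t *: v + p).
  by move=> v w /addIr/(scalerI t0).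
apply: (@leq_trans #|[set v | (v != 0%R) && (t *: v + p \in used)%R]|).
  rewrite -sum1_card big_mkcond [leqRHS]big_mkcond; apply: leq_sum => v _.
  by rewrite inE /N; case: (v != 0%R); case: (_ \in _).
rewrite -(card_imset _ tinj); apply: subset_leq_card.
by apply/subsetP => _ /imsetP[v vP ->]; move: vP; rewrite inE => /andP[].
Qed.

(** The restriction has degree below d and at least d roots, so it is zero. By linearity, two
    codewords agreeing at these points agree at p. *)
Lemma lifted_RS_recover d (c : {ffun 'rV[F]_m -> F^o}) (p v : 'rV[F]_m)
    (T : {set F}) :
  (d <= #|T|)%N -> c \in lifted_RS F m d ->
  (forall t, t \in T -> c (t *: v + p) = 0) -> c p = 0.
Proof.
move=> dT /lifted_RSP; move: (leq_trans dT (max_card _)) => dF /(_ dF v p).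
move=> [f sf fE] c0; rewrite -[p]add0r -(scale0r v) fE.
rewrite (@roots_geq_poly_eq0 _ f (enum T)) ?horner0 ?enum_uniq //.
  by apply/allP => t; rewrite mem_enum => /c0 ct; rewrite rootE -fE ct.
by rewrite -cardE (leq_trans sf).
Qed.

Lemma batch_lifted_RS r k : (0 < m)%N -> (1 <= r < #|F|)%N ->
  (forall j, j < k -> j * #|F| < #|F| ^ m.-1 * r)%N ->
  batch_code_nat (lifted_RS F m (#|F| - r)) k.
Proof.
move=> m0 /andP[r1 rq] hk; set C := lifted_RS _ _ _.
have [enc [p [encC encp]]] := systematic_encoding C.
exists enc; split=> [x y xy|y|w]; first by apply/rowP => i; rewrite -!encp xy.
  exact: encC.
(* The value 0 is a default for j >= k. *)
pose pt j := if insub j is Some i then p (tnth w i) else 0.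
pose good j (X : {set 'rV[F]_m}) := exists v (T : {set F}),
  #|T| = (#|F| - r)%N /\ X = [set t *: v + pt j | t in T].
have [||S [Sg Sd]] := @greedy_disjoint _ good (#|F| - r) k.
- by move=> j X [v [T [<- ->]]]; apply: leq_imset_card.
- move=> j used jk ju.
  (* The direction v may be 0; in that case the requested point is free and forms the recovery set
     alone. *)
  have [v vr] : exists v, (#|hits used (pt j) v| < r)%N.
    apply: exists_direction.
    have := hk j jk; have -> : (#|F| ^ m = #|F| * #|F| ^ m.-1)%N by rewrite -expnS prednK.
    have : (0 < #|F| ^ m.-1)%N by rewrite expn_gt0 (leq_trans _ rq).
    move: #|used| (#|F| ^ m.-1)%N ju => u Q ju Q0 jq; apply: used_bound ju jq => //.
    by rewrite r1.
  set hit := hits _ _ _ in vr.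
  (* At most r - 1 hits and the parameter 0 are discarded. *)
  have : (#|F| - r <= #|~: (0%R |: hit)|)%N.
    rewrite [leqRHS]cardsCs setCK leq_sub2l //.
    by apply: leq_trans (leq_card_setU _ _).1 _; rewrite cards1 add1n.
  move=> /exists_subset[T Tsub cT].
  exists [set t *: v + pt j | t in T]; first by exists v, T.
  rewrite disjoint_subset; apply/subsetP => _ /imsetP[t /(subsetP Tsub) tT ->].
  by move: tT; rewrite !inE negb_or => /andP[-> ]; rewrite negb_and.
(* Decoding takes any message whose codeword matches the symbols read; all of them share the
   requested symbol by [lifted_RS_recover]. *)
pose g (j : 'I_k) (z : {ffun {s | s \in S j} -> F}) : F :=
  if [pick x | project (enc x) (S j) == z] is Some x then x 0 (tnth w j) else 0.
exists (fun j : 'I_k => S j), g; split=> [i j ij|x j].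
  have [lt|gt|/val_inj/eqP eq] := ltngtP i j.
  - by rewrite Sd // lt ltn_ord.
  - by rewrite disjoint_sym Sd // gt ltn_ord.
  - by rewrite eq in ij.
rewrite /g; case: pickP => [y /eqP yx|/(_ x)]; last by rewrite eqxx.
have [v [T [cT SE]]] := Sg j (ltn_ord j).
have ptj : pt j = p (tnth w j) by rewrite /pt valK.
apply/eqP; rewrite -!encp -subr_eq0; apply/eqP.
have -> : enc y (p (tnth w j)) - enc x (p (tnth w j))
    = (enc y - enc x) (p (tnth w j)) by rewrite !ffunE.
apply: (@lifted_RS_recover (#|F| - r) _ _ v T); first by rewrite cT.
  by rewrite rpredB //; apply/encC; [exists y|exists x].
move=> t tT; have tS : t *: v + p (tnth w j) \in S j.
  by rewrite SE -ptj; apply/imsetP; exists t.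
move/ffunP/(_ (exist (fun s => s \in S j) _ tS)): yx.
by rewrite !ffunE /= => ->; rewrite subrr.
Qed.

End Recovery.

(** * The rate *)

Lemma powR_log2 (R : realType) (rho : R) k : 1 <= rho ->
  (2 ^+ k) `^ (ln rho / ln 2) = rho ^+ k.
Proof.
move=> rho1; have ln2 : ln 2 != 0 :> R by rewrite gt_eqF // ln_gt0 // ltr1n.
rewrite -powR_mulrn ?ler0n // -powRrM mulrC powRrM powR_mulrn ?powR_ge0 //.
congr (_ ^+ _); rewrite /powR pnatr_eq0 /= divfK // lnK //.
by rewrite posrE (lt_le_trans _ rho1).
Qed.

Lemma code_lengthE (F : finFieldType) m (C : code F 'rV[F]_m) :
  code_length C = (#|F| ^ m)%N.
Proof. by rewrite /code_length card_mx mul1n. Qed.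

Lemma corate_lifted_RS (R : realType) (F : finFieldType) m l r :
  #|F| = (2 ^ l)%N ->
  1 - code_rate R (lifted_RS F m (#|F| - r))
  = (num_bad (2 ^ l) (2 ^ l - r) m)%:R / (2 ^+ l) ^+ m.
Proof.
move=> hq; have l0 : (0 < l)%N.
  by rewrite lt0n; apply: contraTneq (card_finNzRing_gt1 F) => l0; rewrite hq l0.
have char2 : 2 \in [pchar F] by apply: finfield.card_finPcharP hq _.
rewrite /code_rate code_lengthE hq.
have := dim_lifted_RS m hq char2 (leq_subr r _).
move=> /(congr1 (fun n => n%:R : R)); rewrite natrD !natrX.
move: (\dim _)%:R (num_bad _ _ _)%:R => x y xy.
have q0 : (2 ^+ l) ^+ m != 0 :> R by rewrite !expf_neq0 // pnatr_eq0.
by rewrite -{1}(divff q0) -mulrBl -xy [x + y]addrC addrK.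
Qed.

(** With 2^s <= r < 2^(s+1), the ratio q / r lies between 2^(l-s-1) and 2^(l-s), so its power of
    exponent log lambda_m lies between the matching powers of rho, the exponent being
    nonnegative. *)
Lemma corate_bounds (R : realType) n : exists2 c : R, 0 < c &
  forall l r, (1 <= r < 2 ^ l)%N ->
  let x : R := ((2 ^ l)%:R / r%:R) `^ (ln (lambda R n.+1) / ln 2 - n.+1%:R) in
  let y : R := (num_bad (2 ^ l) (2 ^ l - r) n.+1)%:R / (2 ^+ l) ^+ n.+1 in
  x <= c * y /\ y <= c * x.
Proof.
have [u [_ _ rho1]] := lambda_mx_perron R n.
have [c0 c00 Nb] := num_reach_bounds R n.
set rho := lambda R n.+1 in rho1 Nb *; set m := n.+1.
(* The factor c0 compares counts with powers of rho, and 2^m pays for replacing r by 2^(s+1) <= 2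
   r. *)
exists (c0 * 2 ^+ m) => [|l r /andP[r1 rq] x y]; first by rewrite mulr_gt0 // exprn_gt0.
pose s := trunc_log 2 r.
have /andP[sr rs] : (2 ^ s <= r < 2 ^ s.+1)%N by apply: trunc_log_bounds.
have sl : (s < l)%N by rewrite -(@ltn_exp2l 2) // (leq_ltn_trans sr).
have [_ lowN] := Nb (l - s)%N; have [upN _] := Nb (l - s.+1)%N.
have r0 : 0 < r%:R :> R by rewrite ltr0n.
have q0 : 0 < 2 ^+ l :> R by rewrite exprn_gt0.
pose z : R := (2 ^+ l / r%:R) `^ (ln rho / ln 2).
have L0 : 0 <= ln rho / ln 2 by rewrite divr_ge0 ?ln_ge0 // ler1n.
have xE : x = z * r%:R ^+ m / (2 ^+ l) ^+ m.
  have qr0 : 2 ^+ l / r%:R != 0 :> R by rewrite gt_eqF ?divr_gt0.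
  rewrite /x natrX powRB ?qr0 ?implybT // powR_mulrn; last first.
    by rewrite divr_ge0 // ltW.
  by rewrite -/z expr_div_n invf_div mulrA.
have zlo : rho ^+ (l - s.+1) <= z.
  rewrite -(powR_log2 _ rho1) /z.
  apply: (ge0_ler_powR L0); rewrite ?nnegrE ?exprn_ge0 ?divr_ge0 ?(ltW q0) ?ler0n //.
  rewrite ler_pdivlMr // -!natrX -natrM ler_nat.
  by rewrite -[in leqRHS](subnK sl) expnD leq_mul2l ltnW ?orbT.
have zhi : z <= rho ^+ (l - s).
  rewrite -(powR_log2 _ rho1) /z.
  apply: (ge0_ler_powR L0); rewrite ?nnegrE ?exprn_ge0 ?divr_ge0 ?(ltW q0) ?ler0n //.
  rewrite ler_pdivrMr // -!natrX -natrM ler_nat.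
  by rewrite -[in leqLHS](subnK (ltnW sl)) expnD leq_mul2l sr orbT.
have z0 : 0 <= z by apply: powR_ge0.
have rho0 k : 0 <= rho ^+ k by rewrite exprn_ge0 // (le_trans ler01).
set b := num_bad _ _ _ in y *.
(* More exponents are bad as r grows: 2^s gives the lower bound and 2^(s+1) the upper one. *)
have blo : (num_reach m (l - s) 0 0 * (2 ^ s) ^ m <= b)%N.
  apply: leq_trans (num_bad_geq _ (ltnW sl)) _.
  by apply: leq_num_bad; apply: leq_sub2l.
have bhi : (b <= num_reach m (l - s.+1) n 0 * (2 ^ s.+1) ^ m)%N.
  apply: leq_trans (num_bad_leq _ sl) => //.
  by apply: leq_num_bad; apply: leq_sub2l; apply: ltnW.
rewrite xE /y !mulrA !ler_pM2r ?invr_gt0 ?exprn_gt0 //; split.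
  apply: (@le_trans _ _ (c0 * (num_reach m (l - s) 0 0)%:R * (2 ^+ s.+1) ^+ m)).
    apply: ler_pM => //; rewrite ?exprn_ge0 ?(le_trans zhi) //.
    by rewrite lerXn2r ?nnegrE ?exprn_ge0 ?ler0n // -natrX ler_nat ltnW.
  rewrite exprS exprMn -!mulrA ler_pM2l // mulrCA ler_pM2l ?exprn_gt0 //.
  by rewrite -!natrX -natrM ler_nat.
apply: (@le_trans _ _ ((num_reach m (l - s.+1) n 0)%:R * (2 ^+ s.+1) ^+ m)).
  by rewrite -!natrX -natrM ler_nat.
rewrite (_ : c0 * 2 ^+ m * z * r%:R ^+ m = c0 * z * (2 * r%:R) ^+ m); last first.
  by rewrite exprMn; ring.
apply: ler_pM; rewrite ?exprn_ge0 ?ler0n //.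
  by apply: le_trans upN _; rewrite ler_pM2l.
rewrite lerXn2r ?nnegrE ?mulr_ge0 ?exprn_ge0 ?ler0n //.
by rewrite exprS ler_pM2l // -natrX ler_nat.
Qed.

(** An integer below the ceiling of x is below x itself, integral or not; multiplying by q clears
    the negative power that occurs for m = 1. *)
Lemma ceil_batch_bound n q r j : (0 < q)%N ->
  (j < `|Num.ceil ((q%:R : rat) ^ (n.+1%:Z - 2) * r%:R)|)%N ->
  (j * q < q ^ n * r)%N.
Proof.
move=> q0; have q0' : (q%:R : rat) != 0 by rewrite pnatr_eq0 -lt0n.
set x := _ * _ => jx.
have x0 : 0 <= x by rewrite mulr_ge0 ?exprz_ge0 ?ler0n.
have c0 : 0 <= Num.ceil x by rewrite ceil_ge0 (lt_le_trans _ x0) // ltrN10.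
have : (j%:Z < Num.ceil x)%R by rewrite -(gez0_abs c0) ltz_nat.
rewrite ceil_gt_int /x => jx'.
have : (j * q)%:R < (q ^ n * r)%:R :> rat; last by rewrite ltr_nat.
have -> : (q ^ n * r)%:R = x * q%:R :> rat.
  rewrite /x (_ : n.+1%:Z - 2 = n%:Z - 1); last by lia.
  by rewrite expfzDr // natrM natrX mulrAC divfK.
by rewrite natrM ltr_pM2r // ltr0n.
Qed.

Theorem theorem2 (R : realType) (m : nat) (hm : (1 <= m)%N) :
  [/\ forall (F : finFieldType) (l r : nat),
        #|F| = (2 ^ l)%N -> (1 <= r < #|F|)%N ->
        code_length (lifted_RS F m (#|F| - r)) = (#|F| ^ m)%N,
      exists c C : R, exists q0 : nat,
        [/\ 0 < c, 0 < C
          & forall (F : finFieldType) (l r : nat),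
              #|F| = (2 ^ l)%N -> (1 <= r < #|F|)%N -> (q0 <= #|F|)%N ->
              let x : R := (#|F|%:R / r%:R) `^ (ln (lambda R m) / ln 2 - m%:R) in
              c * x <= 1 - code_rate R (lifted_RS F m (#|F| - r)) <= C * x]
    & forall (F : finFieldType) (l r : nat),
        #|F| = (2 ^ l)%N -> (1 <= r < #|F|)%N ->
        batch_code (lifted_RS F m (#|F| - r))
          ((#|F|%:R : rat) ^ (m%:Z - 2) * r%:R)].
Proof.
case: m hm => // n _; split=> [F l r _ _||F l r _ r_bounds].
- exact: code_lengthE.
- have [c c0 bounds] := corate_bounds R n.
  (* The bounds of [corate_bounds] hold for every q, whence the threshold 0. *)
  exists c^-1, c, 0%N; split; rewrite ?invr_gt0 // => F l r hq r_bounds _ /=.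
  rewrite (corate_lifted_RS R n.+1 r hq) hq ler_pdivrMl //.
  by apply/andP; apply: bounds; rewrite -hq.
- apply: batch_lifted_RS => // j jk.
  apply: ceil_batch_bound jk; exact: ltnW (card_finNzRing_gt1 F).
Qed.
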